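(* Let $\mathcal C$ be an irreducible curve of $\mathbb P^3$. Let $\mathcal B$ be a branch of type $(e,r,s)$ of $\mathcal C$ with parametrization (after a linear change of variables) $$\alpha=[\alpha_1:\alpha_2:\alpha_3:1]:u\mapsto\Bigl[u^e\sum_{n\ge0}a_nu^n:u^r\sum_{k\ge0}b_ku^k:u^s\sum_{\ell\ge0}c_\ell u^\ell:1\Bigr],$$ where $0<e<r<s$, $a_0=b_0=c_0=1$, the components are in $\mathbb C[[u]]$, and where (without loss of generality) $n_0\ne r$ and $k_0\ne s$, with $n_0:=\inf\{n\ge1: a_n\ne0\}$ and $k_0:=\inf\{k\ge1: b_k\ne0\}$. Put $\gamma:=\sum_{k=0}^s a_ka_{s-k}-b_s$. (1) If $r\ne2e$ and $s\ne2e$, then for a generic quadric $\mathcal Q$, $\Phi_{\mathcal C,\mathcal Q}(\mathcal B)$ is a branch of type $(a,b,c)$ with $\{a,b,c\}=\{e,r-e,s-e\}$. (2) If $r=2e$ and if $s\ne\min(\operatorname{val}(\alpha_1^2-\alpha_2),3e)$, then for a generic quadric $\mathcal Q$, $\Phi_{\mathcal C,\mathcal Q}(\mathcal B)$ is a branch of type $(a,b,c)$ with $\{a,b,c\}=\{e,\min(2e,\operatorname{val}(\alpha_1^2-\alpha_2)-e),s-e\}$. (3) If $r=2e$ and if $s=\operatorname{val}(\alpha_1^2-\alpha_2)<3e$, then for a generic quadric $\mathcal Q$, $\Phi_{\mathcal C,\mathcal Q}(\mathcal B)$ is a branch of type $$\bigl(e,\ s-e,\ \min(2e,\operatorname{val}(\alpha_1^2-\alpha_2-\gamma\alpha_3)-e)\bigr).$$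 (4) If $r=2e$ and if $s=3e\le\operatorname{val}(\alpha_1^2-\alpha_2)$, then for a generic quadric $\mathcal Q$, $\Phi_{\mathcal C,\mathcal Q}(\mathcal B)$ is a branch of type $$\bigl(e,\ 2e,\ \min(3e,\ \operatorname{val}(\alpha_1^2-\alpha_2-\gamma\alpha_3)-e,\ \operatorname{val}(\alpha_1\alpha_2-2\alpha_3)-e,\ \operatorname{val}(\alpha_1'\alpha_2-2\alpha_2'\alpha_1+\alpha_3')-e+1)\bigr).$$ (5) If $s=2e$, then for a generic quadric $\mathcal Q$, $\Phi_{\mathcal C,\mathcal Q}(\mathcal B)$ is a branch of type $\bigl(r-e,\ e,\ \min(\operatorname{val}(\alpha_1^2-\alpha_3)-e,\,2e)\bigr)$.
   Context: Everything is over $\mathbb C$. Quadrics $\mathcal Q=V(Q)$ of $\mathbb P^3$ are parametrized by $\mathbb P^9$, and ''generic quadric'' is meant in the usual sense of algebraic geometry. $\operatorname{val}$ is the $u$-adic valuation on $\mathbb C[[u]]$, and $'$ is the derivative with respect to $u$. Type of a branch: a branch at a point $m_0$ of a curve of $\mathbb P^3$ has type $(e,r,s)$ if, up to a linear change of coordinates, $m_0=[0:0:0:1]$ and the branch is parametrized by $u\mapsto[u^e\sum_{n\ge0}a_nu^n:u^r\sum_{k\ge0}b_ku^k:u^s\sum_{\ell\ge0}c_\ell u^\ell:1]$ with components in $\mathbb C[[u]]$, $0<e<r<s$ and $a_0=b_0=c_0=1$. Halphen map: let $\mathcal Q=V(Q)$ be an irreducible quadric and let $\mathfrak b_Q(\mathbf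 m_1,\mathbf m_2)=[Q(\mathbf m_1+\mathbf m_2)-Q(\mathbf m_1-\mathbf m_2)]/4$ be the symmetric bilinear form associated to $Q$. For $m\in\mathcal C$, $\Phi_{\mathcal C,\mathcal Q}(m)$ is the intersection point of the tangent line $\mathcal T_m\mathcal C$ with the polar plane $\delta_m\mathcal Q=\{p:\mathfrak b_Q(\mathbf m,\mathbf p)=0\}$ of $\mathcal Q$ with respect to $m$ (when this point is well defined). The Halphen transform $\mathcal C^{\mathcal Q}$ is the Zariski closure of the image of $\mathcal C$ by $\Phi_{\mathcal C,\mathcal Q}$. If $\alpha$ parametrizes a branch $\mathcal B$ of $\mathcal C$, then $\Phi_{\mathcal C,\mathcal Q}(\mathcal B)$ is the branch of $\mathcal C^{\mathcal Q}$ parametrized by $$u\mapsto[\mathfrak b_Q(\alpha(u),\alpha'(u))\cdot\alpha(u)-Q(\alpha(u))\cdot\alpha'(u)].$$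
   Formalization: γ is taken as the coefficient of u^s in α₁²−α₂ (a_k, b_k read as coefficients of u^k in α₁, α₂); in (4) α₁α₂−2α₃ is corrected to α₁α₂−α₃; in (5) the bound 2e is corrected to r. The formulas as printed are false. *)

(* Defs.v *)
From HB Require Import structures.
From mathcomp Require Import all_boot all_order all_algebra.
From mathcomp Require Import boolp reals complex mpoly.

Set Implicit Arguments.
Unset Strict Implicit.
Unset Printing Implicit Defensive.

Import GRing.Theory.
Local Open Scope ring_scope.

(** * Formal power series in one variable u *)

Record fps (K : Type) : Type := Fps { fcoef :> nat -> K }.

HB.instance Definition _ (K : Type) := gen_eqMixin (fps K).
HB.instance Definition _ (K : Type) := gen_choiceMixin (fps K).

Lemma fpsP (K : Type) (f g : fps K) : (forall n, f n = g n) -> f = g.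
Proof. by case: f g => [f] [g] /= h; congr Fps; apply: functional_extensionality_dep. Qed.

Section FpsRing.
Variable K : comNzRingType.
Implicit Types f g h : fps K.

Definition fpsC (x : K) : fps K := Fps (fun n => if n == 0%N then x else 0).
Definition fps_add f g : fps K := Fps (fun n => f n + g n).
Definition fps_opp f : fps K := Fps (fun n => - f n).
Definition fps_mul f g : fps K :=
  Fps (fun n => \sum_(k < n.+1) f k * g (n - k)%N).

Lemma fps_addA : associative fps_add.
Proof. by move=> f g h; apply: fpsP => n /=; rewrite addrA. Qed.
Lemma fps_addC : commutative fps_add.
Proof. by move=> f g; apply: fpsP => n /=; rewrite addrC. Qed.
Lemma fps_add0 : left_id (fpsC 0) fps_add.
Proof. by move=> f; apply: fpsP => n /=; rewrite if_same add0r. Qed.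
Lemma fps_addN : left_inverse (fpsC 0) fps_opp fps_add.
Proof. by move=> f; apply: fpsP => n /=; rewrite if_same addNr. Qed.

HB.instance Definition _ :=
  GRing.isZmodule.Build (fps K) fps_addA fps_addC fps_add0 fps_addN.

Let trunc N f : {poly K} := \poly_(i < N.+1) f i.

Let coef_trunc N f n : (n <= N)%N -> (trunc N f)`_n = f n.
Proof. by move=> le_nN; rewrite coef_poly ltnS le_nN. Qed.

Let coef_mul N f g n : (n <= N)%N ->
  (trunc N f * trunc N g)`_n = fps_mul f g n.
Proof.
move=> le_nN; rewrite coefM; apply: eq_bigr => k _.
rewrite !coef_trunc //; first by rewrite (leq_trans (leq_subr _ _)).
by rewrite (leq_trans _ le_nN) // -ltnS.
Qed.

Lemma fps_mulC : commutative fps_mul.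
Proof. by move=> f g; apply: fpsP => n; rewrite -!(@coef_mul n) // mulrC. Qed.

Lemma fps_mulA : associative fps_mul.
Proof.
move=> f g h; apply: fpsP => n.
have lek (k : 'I_n.+1) : (k <= n)%N by rewrite -ltnS.
transitivity ((trunc n f * trunc n g * trunc n h)`_n).
  rewrite -mulrA coefM; apply: eq_bigr => k _.
  by rewrite coef_trunc // coef_mul // leq_subr.
rewrite coefM; apply: eq_bigr => k _.
by rewrite coef_mul // coef_trunc // leq_subr.
Qed.

Lemma fps_mul1 : left_id (fpsC 1) fps_mul.
Proof.
move=> f; apply: fpsP => n /=.
rewrite big_ord_recl /= mul1r subn0 big1 ?addr0 // => i _.
by rewrite /= mul0r.
Qed.

Lemma fps_mulD : left_distributive fps_mul fps_add.
Proof.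
move=> f g h; apply: fpsP => n /=; rewrite -big_split /=.
by apply: eq_bigr => k _; rewrite mulrDl.
Qed.

Lemma fps_1neq0 : fpsC 1 != 0.
Proof.
apply/eqP => /(congr1 (fun f : fps K => f 0%N)) /= /eqP.
by rewrite oner_eq0.
Qed.

HB.instance Definition _ :=
  GRing.Zmodule_isComNzRing.Build (fps K)
    fps_mulA fps_mulC fps_mul1 fps_mulD fps_1neq0.

Definition fpsX : fps K := Fps (fun k => (k == 1%N)%:R).

Definition fps_deriv f : fps K := Fps (fun n => f n.+1 *+ n.+1).

End FpsRing.

Notation "''u'" := (fpsX _) (at level 0).

(** * Infima in N with +oo, written [None] *)

Definition nat_inf (P : pred nat) : option nat :=
  if pselect (exists n, P n) is left ex then Some (ex_minn ex) else None.

(* min(N, v), for v in N with +oo *)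
Definition min_on (N : nat) (v : option nat) : nat :=
  if v is Some n then minn N n else N.

(* N <= v, for v in N with +oo *)
Definition le_on (N : nat) (v : option nat) : bool :=
  if v is Some n then (N <= n)%N else true.

(* v - k, for v in N with +oo; the subtraction is truncated *)
Definition sub_on (v : option nat) (k : nat) : option nat :=
  omap (fun n => (n - k)%N) v.

Definition add_on (v : option nat) (k : nat) : option nat :=
  omap (fun n => (n + k)%N) v.

Section Valuation.
Variable K : comNzRingType.

Definition val_u (f : fps K) : option nat := nat_inf (fun n => f n != 0).

(* inf {n >= 1 | f_n <> 0} *)
Definition second_exponent (f : fps K) : option nat :=
  nat_inf (fun n => (1 <= n)%N && (f n != 0)).

End Valuation.

(** * Projective algebraic sets of P^3 *)

Section Projective.
Variable K : fieldType.

(* Points of P^3 are given by their nonzero coordinate vectors: a subset of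
   P^3 is represented by the set of all the coordinate vectors of its points. *)
Implicit Types (X Y Z : 'rV[K]_4 -> Prop) (F Q : {mpoly K[4]}).
Implicit Types (v w m p t : 'rV[K]_4).

Definition vanishes X F : Prop := forall v, X v -> F.@[v 0] = 0.

Definition zariski_closure X v : Prop :=
  v != 0 /\ forall d F, F \is d.-homog -> vanishes X F -> F.@[v 0] = 0.

(* Equivalently, X is the zero locus of a family of homogeneous polynomials. *)
Definition zariski_closed X : Prop := forall v, X v <-> zariski_closure X v.

Definition irreducible_closed X : Prop :=
  [/\ zariski_closed X, exists v, X v &
      forall Y Z, zariski_closed Y -> zariski_closed Z ->
        (forall v, X v -> Y v \/ Z v) ->
        (forall v, X v -> Y v) \/ (forall v, X v -> Z v)].

(* Algebraic independence over K in the homogeneous coordinate ring of X. *)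
Definition alg_independent X (k : nat) (f : k.-tuple {mpoly K[4]}) : Prop :=
  forall P : {mpoly K[k]}, vanishes X (P \mPo f) -> P = 0.

(* The homogeneous coordinate ring of X has transcendence degree dim X + 1. *)
Definition proj_dim X (d : nat) : Prop :=
  (exists f : d.+1.-tuple {mpoly K[4]}, alg_independent X f) /\
  (forall f : d.+2.-tuple {mpoly K[4]}, ~ alg_independent X f).

Definition irreducible_curve X : Prop := irreducible_closed X /\ proj_dim X 1.

(* The linear subspace of K^4 underlying the projective tangent space at m. *)
Definition tangent_space X m p : Prop :=
  forall F, vanishes X F -> \sum_(i < 4) (F^`M(i)).@[m 0] * p 0 i = 0.

(* The projective tangent space at m is a line. *)
Definition nonsingular_point X m : Prop :=
  X m /\ exists t, (forall x, t <> x *: m) /\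
    forall p, tangent_space X m p <-> exists x y, p = x *: m + y *: t.

(** * Quadrics and the Halphen transform *)

Definition quadric_monomials : seq ('I_4 * 'I_4) :=
  let i k : 'I_4 := inord k in
  [:: (i 0, i 0); (i 0, i 1); (i 0, i 2); (i 0, i 3); (i 1, i 1);
      (i 1, i 2); (i 1, i 3); (i 2, i 2); (i 2, i 3); (i 3, i 3)]%N.

Definition quadric (q : 'rV[K]_10) : {mpoly K[4]} :=
  \sum_(k < 10) q 0 k *:
    let ij := nth (ord0, ord0) quadric_monomials k in 'X_(ij.1) * 'X_(ij.2).

(* P holds on a nonempty Zariski open subset of the P^9 of quadrics; the
   nonvanishing locus of G is nonempty as soon as K is infinite. *)
Definition for_generic_quadric (P : {mpoly K[4]} -> Prop) : Prop :=
  exists (d : nat) (G : {mpoly K[10]}),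
    [/\ G \is d.-homog, G != 0 &
        forall q : 'rV[K]_10, q != 0 -> G.@[q 0] != 0 -> P (quadric q)].

Definition polar_form Q v w : K :=
  (Q.@[(v + w) 0] - Q.@[(v - w) 0]) / 4%:R.

(* [p] = Phi_{X,Q}(m): the tangent line at m meets the polar plane of m
   exactly at the point [p]. *)
Definition halphen_point X Q m p : Prop :=
  [/\ nonsingular_point X m, p != 0 &
      forall p', (tangent_space X m p' /\ polar_form Q m p' = 0) <->
                 exists x, p' = x *: p].

Definition halphen_transform X Q : 'rV[K]_4 -> Prop :=
  zariski_closure (fun p => exists m, halphen_point X Q m p).

(** * Branches *)

Implicit Types alpha beta : 'rV[fps K]_4.

Definition eval_fps F alpha : fps K := mmap (@fpsC K) (alpha 0) F.

Definition polar_form_fps Q alpha beta : fps K :=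
  fpsC (4%:R^-1) * (eval_fps Q (alpha + beta) - eval_fps Q (alpha - beta)).

Definition deriv_param alpha : 'rV[fps K]_4 := map_mx (@fps_deriv K) alpha.

Definition halphen_param Q alpha : 'rV[fps K]_4 :=
  polar_form_fps Q alpha (deriv_param alpha) *: alpha
    - eval_fps Q alpha *: deriv_param alpha.

Definition lies_on X beta : Prop :=
  forall d F, F \is d.-homog -> vanishes X F -> eval_fps F beta = 0.

Definition standard_param (e r s : nat) (a b c : fps K) : 'rV[fps K]_4 :=
  \row_(j < 4) nth 0 [:: 'u ^+ e * a; 'u ^+ r * b; 'u ^+ s * c; 1] j.

(* beta is projectively equal to the standard parametrization, up to a linear
   change of coordinates. The factor lam may vanish at u = 0: homogeneous
   coordinates in K[[u]] may have a common factor. *)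
Definition normal_form beta (e r s : nat) (a b c : fps K) : Prop :=
  [/\ (0 < e < r)%N, (r < s)%N, [/\ a 0%N = 1, b 0%N = 1 & c 0%N = 1] &
      exists (M : 'M[K]_4) (lam : fps K),
        [/\ M \in unitmx, lam != 0 &
            beta *m map_mx (@fpsC K) M = lam *: standard_param e r s a b c]].

Definition branch_of_type X beta (e r s : nat) : Prop :=
  lies_on X beta /\ exists a b c, normal_form beta e r s a b c.

End Projective.

(* Main.v *)
(** The Halphen map is read off a single function. Along a parametrized branch,
    let [Q] denote the value of the quadratic form and [b] half its derivative. A
    linear form taking the value [L] on the branch takes the value [b L - Q L']
    on its image, and this is [- Q^(3/2)] times the derivative of [L / sqrt Q].
    The coordinate forms therefore vanish to orders [e - 1], [r - 1] and [s - 1]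
    on the image. The fourth order of vanishing is obtained from the linear form
    closest to [sqrt Q]: normalized by [L(0) = Q(0) = q], it is one less than the
    order of [L^2 - q Q], a quadratic expression in the components of the branch
    whose leading coefficient is, for a generic quadric, not 0.

    That the image lies on the Halphen transform follows from two facts. First, a
    branch is a generic point of its curve: a polynomial vanishing on the branch
    vanishes on the curve, as otherwise it would be algebraically independent of
    two coordinates, in dimension 1. Second, in characteristic 0 there are two
    equations of the curve whose gradients cut out the tangent line generically,
    and the cross product of these gradients with the polar covector is a
    polynomial form of the Halphen map. *)

Require Import Defs.
From HB Require Import structures.
From mathcomp Require Import all_boot all_order all_algebra.
From mathcomp Require Import boolp reals complex mpoly ring zify.

Set Implicit Arguments.
Unset Strict Implicit.
Unset Printing Implicit Defensive.

Import GRing.Theory.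
Local Open Scope ring_scope.

(** The linear form closest to the square root keeps two free coefficients, its corrections along
    [y] and [z], where [x], [y], [z] are the affine coordinates of the branch. They can cancel the
    terms of [L^2 - q Q] linear in [y] and [z], and with them the products of coordinates having the
    same leading term as [y] or [z]. This is the origin of the bounds in the statement. If [r = 2e],
    then [y] absorbs [x^2] and the next product is [x y], of order [3e]. If moreover [s = 3e], then
    [z] absorbs [x y], and [x z] and [y^2] remain, of order [4e]. If [s = 2e], then [z] absorbs
    [x^2], and [x y] remains, of order [e + r]. The corrections must also make the order found
    distinct from [r] and [s]: four forms of distinct orders are a basis, and the type consists of
    the differences with the least order, which comes from [e]. Everything stays polynomial: square
    roots are replaced by an identity between derivatives, and divisions by [2 q] are cleared, so
    that each leading coefficient becomes a homogeneous polynomial in the quadric, shown to be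
    nonzero on an explicit example. *)

Section FpsCoefficients.
Variable K : comNzRingType.
Implicit Types f g h : fps K.

Lemma coef_fpsD f g n : (f + g) n = f n + g n. Proof. by []. Qed.
Lemma coef_fpsN f n : (- f) n = - f n. Proof. by []. Qed.
Lemma coef_fpsB f g n : (f - g) n = f n - g n. Proof. by []. Qed.
Lemma coef_fpsM f g n : (f * g) n = \sum_(k < n.+1) f k * g (n - k)%N.
Proof. by []. Qed.
Lemma coef_fps0 n : (0 : fps K) n = 0.
Proof. by rewrite /= if_same. Qed.
Lemma coef_fps1 n : (1 : fps K) n = (n == 0%N)%:R.
Proof. by rewrite /=; case: eqP. Qed.
Lemma coef_fps_deriv f n : fps_deriv f n = f n.+1 *+ n.+1. Proof. by []. Qed.

Lemma coef_fps_sum I (s : seq I) (P : pred I) (F : I -> fps K) n :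
  (\sum_(i <- s | P i) F i) n = \sum_(i <- s | P i) F i n.
Proof.
elim/big_rec2: _ => [|i x f _ IH]; first by rewrite coef_fps0.
by rewrite coef_fpsD IH.
Qed.

Lemma fpsC_is_zmod_morphism : zmod_morphism (@fpsC K).
Proof. by move=> x y; apply: fpsP => -[|n] //=; rewrite subr0. Qed.

Lemma coef_fpsCM (x : K) f n : (fpsC x * f) n = x * f n.
Proof.
rewrite coef_fpsM big_ord_recl /= subn0 big1 ?addr0 // => i _.
by rewrite /= mul0r.
Qed.

Lemma fpsC_is_monoid_morphism : monoid_morphism (@fpsC K).
Proof.
split=> // x y; apply: fpsP => n; rewrite coef_fpsCM /=.
by case: eqP; rewrite ?mulr0.
Qed.

HB.instance Definition _ :=
  GRing.isZmodMorphism.Build K (fps K) (@fpsC K) fpsC_is_zmod_morphism.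
HB.instance Definition _ :=
  GRing.isMonoidMorphism.Build K (fps K) (@fpsC K) fpsC_is_monoid_morphism.

Lemma coef_fpsXn n k : ('u ^+ n : fps K) k = (k == n)%:R.
Proof.
elim: n k => [|n IHn] k; first by rewrite expr0 coef_fps1.
rewrite exprS coef_fpsM; case: k => [|k].
  by rewrite big_ord_recl big_ord0 /= mul0r addr0.
rewrite big_ord_recl /= mul0r add0r big_ord_recl /= mul1r subSS subn0 big1.
  by rewrite addr0 IHn eqSS.
by move=> i _; rewrite /= mul0r.
Qed.

Lemma coef_fpsXnM n f k :
  ('u ^+ n * f) k = if (k < n)%N then 0 else f (k - n)%N.
Proof.
rewrite coef_fpsM; case: ltnP => [lt_kn|le_nk].
  rewrite big1 // => i _; rewrite coef_fpsXn.
  by rewrite ltn_eqF ?mul0r // (leq_ltn_trans _ lt_kn) // -ltnS.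
have ltnk : (n < k.+1)%N by [].
rewrite (bigD1 (Ordinal ltnk)) //= coef_fpsXn eqxx mul1r big1 ?addr0 // => i.
rewrite -val_eqE /= => ne; rewrite coef_fpsXn (negbTE ne) mul0r //.
Qed.

Lemma fps_deriv_is_zmod_morphism : zmod_morphism (@fps_deriv K).
Proof. by move=> f g; apply: fpsP => n /=; rewrite mulrnBl. Qed.

HB.instance Definition _ :=
  GRing.isZmodMorphism.Build (fps K) (fps K) (@fps_deriv K)
    fps_deriv_is_zmod_morphism.

Lemma fps_derivC (x : K) : fps_deriv (fpsC x) = 0.
Proof. by apply: fpsP => n; rewrite /= mul0rn if_same. Qed.

(* Both sides only involve finitely many coefficients, so that the rule follows
   from the one for polynomials. *)
Lemma fps_derivM f g : fps_deriv (f * g) = fps_deriv f * g + f * fps_deriv g.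
Proof.
apply: fpsP => n.
pose trunc (h : fps K) : {poly K} := \poly_(i < n.+2) h i.
have cT h k : (k <= n.+1)%N -> (trunc h)`_k = h k.
  by move=> lekn; rewrite coef_poly ltnS lekn.
have -> : fps_deriv (f * g) n = ((trunc f * trunc g)^`())`_n.
  rewrite coef_deriv coef_fps_deriv coefM coef_fpsM; congr (_ *+ _).
  apply: eq_bigr => i _; rewrite !cT //; have := ltn_ord i; lia.
rewrite derivM coefD !coefM coef_fpsD !coef_fpsM; congr (_ + _).
  apply: eq_bigr => i _; rewrite coef_deriv !cT //; have := ltn_ord i; lia.
apply: eq_bigr => i _; rewrite coef_deriv !cT //; have := ltn_ord i; lia.
Qed.

(** * Orders of vanishing *)

Definition ord_ge (n : nat) f : Prop := forall k, (k < n)%N -> f k = 0.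

Definition has_ord (n : nat) f : Prop := ord_ge n f /\ f n != 0.

Lemma ord_geW m n f : (m <= n)%N -> ord_ge n f -> ord_ge m f.
Proof. by move=> le_mn fn k lt_km; apply: fn; apply: leq_trans le_mn. Qed.

Lemma ord_ge0 f : ord_ge 0 f. Proof. by []. Qed.

Lemma ord_geS n f : ord_ge n f -> f n = 0 -> ord_ge n.+1 f.
Proof.
by move=> fn fn0 k; rewrite ltnS leq_eqVlt => /predU1P[->|/fn].
Qed.

Lemma ord_ge_zero n : ord_ge n 0. Proof. by move=> k _; rewrite coef_fps0. Qed.

Lemma ord_geD n f g : ord_ge n f -> ord_ge n g -> ord_ge n (f + g).
Proof. by move=> fn gn k lt_kn; rewrite coef_fpsD fn // gn // addr0. Qed.

Lemma ord_geN n f : ord_ge n f -> ord_ge n (- f).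
Proof. by move=> fn k lt_kn; rewrite coef_fpsN fn // oppr0. Qed.

Lemma ord_geB n f g : ord_ge n f -> ord_ge n g -> ord_ge n (f - g).
Proof. by move=> fn gn; apply: ord_geD => //; apply: ord_geN. Qed.

Lemma ord_geM m n f g : ord_ge m f -> ord_ge n g -> ord_ge (m + n) (f * g).
Proof.
move=> fm gn k lt_k; rewrite coef_fpsM big1 // => -[i /= lt_i] _.
have [lt_im|le_mi] := ltnP i m; first by rewrite fm ?mul0r.
by rewrite gn ?mulr0 //; lia.
Qed.

Lemma ord_geMl n f g : ord_ge n g -> ord_ge n (f * g).
Proof. exact: (ord_geM (ord_ge0 f)). Qed.

Lemma ord_geMr n f g : ord_ge n f -> ord_ge n (f * g).
Proof. by move=> fn; rewrite mulrC; apply: ord_geMl. Qed.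

Lemma ord_ge_deriv n f : ord_ge n.+1 f -> ord_ge n (fps_deriv f).
Proof. by move=> fn k lt_kn; rewrite coef_fps_deriv fn ?mul0rn. Qed.

Lemma ord_geMn n f k : ord_ge n f -> ord_ge n (f *+ k).
Proof.
move=> fn; elim: k => [|k IHk]; first by rewrite mulr0n; exact: ord_ge_zero.
by rewrite mulrS; apply: ord_geD.
Qed.

Lemma coef_ord_geM m n f g :
  ord_ge m f -> ord_ge n g -> (f * g) (m + n)%N = f m * g n.
Proof.
move=> fm gn; have lt_m : (m < (m + n).+1)%N by lia.
rewrite coef_fpsM (bigD1 (Ordinal lt_m)) //= addKn big1 ?addr0 // => -[i /= lti].
rewrite -val_eqE /= neq_ltn => /orP[lt_im|lt_mi]; first by rewrite fm ?mul0r.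
by rewrite gn ?mulr0 //; lia.
Qed.

Lemma ord_ge_Xn n f : ord_ge n ('u ^+ n * f).
Proof. by move=> k lt_kn; rewrite coef_fpsXnM lt_kn. Qed.

Lemma ord_geP n f : ord_ge n f -> exists g, f = 'u ^+ n * g /\ g 0%N = f n.
Proof.
move=> fn; exists (Fps (fun k => f (k + n)%N)); split=> //; apply: fpsP => k.
by rewrite coef_fpsXnM; case: ltnP => [/fn//|le_nk] /=; rewrite subnK.
Qed.

Lemma has_ord_neq0 n f : has_ord n f -> f != 0.
Proof. by case=> _; apply: contraNneq => ->; rewrite coef_fps0. Qed.

Lemma fps_neq0_ord f : f != 0 -> exists n, has_ord n f.
Proof.
move=> f0; have [ex|nof] := pselect (exists n, f n != 0).
  case: (ex_minnP ex) => m fm min_m; exists m; split=> // k lt_km.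
  by apply/eqP; apply: contraTT lt_km => /min_m; rewrite -leqNgt.
case/eqP: f0; apply: fpsP => n; rewrite coef_fps0; apply/eqP.
by apply: contraPT nof => fn nof; apply: nof; exists n.
Qed.

Lemma val_u_ord f :
  if val_u f is Some n then has_ord n f else f = 0.
Proof.
rewrite /val_u /nat_inf; case: pselect => [ex|nex]; last first.
  apply: fpsP => n; rewrite coef_fps0; apply/eqP.
  by apply: contraPT nex => fn nof; apply: nof; exists n.
case: ex_minnP => m fm min_m; split=> // k lt_km.
by apply/eqP; apply: contraTT lt_km => /min_m; rewrite -leqNgt.
Qed.

End FpsCoefficients.

(** * The integral domain of power series over a field *)

Section FpsDomain.
Variable K : fieldType.
Implicit Types f g h : fps K.

Lemma has_ordM m n f g : has_ord m f -> has_ord n g -> has_ord (m + n) (f * g).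
Proof.
move=> [fm fm0] [gn gn0]; split; first exact: ord_geM.
by rewrite coef_ord_geM // mulf_neq0.
Qed.

Lemma fps_mulf_eq0 f g : f * g = 0 -> (f == 0) || (g == 0).
Proof.
move=> fg0; apply/norP => -[/fps_neq0_ord[m fm] /fps_neq0_ord[n gn]].
by move: (has_ord_neq0 (has_ordM fm gn)); rewrite fg0 eqxx.
Qed.

Definition fps_unit f : bool := `[< exists g, g * f = 1 >].

Definition fps_inv f : fps K :=
  if pselect (exists g, g * f = 1) is left ex then projT1 (cid ex) else f.

Lemma fps_mulVf : {in fps_unit, left_inverse 1 fps_inv *%R}.
Proof.
move=> f /asboolP uf; rewrite /fps_inv.
by case: pselect => // ex; case: cid.
Qed.

Lemma fps_unitPl f g : g * f = 1 -> fps_unit f.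
Proof. by move=> gf; apply/asboolP; exists g. Qed.

Lemma fps_inv_out : {in [predC fps_unit], fps_inv =1 id}.
Proof.
move=> f; rewrite inE /fps_inv => /asboolP nu.
by case: pselect.
Qed.

HB.instance Definition _ :=
  GRing.ComNzRing_hasMulInverse.Build (fps K) fps_mulVf fps_unitPl fps_inv_out.
HB.instance Definition _ :=
  GRing.ComUnitRing_isIntegral.Build (fps K) fps_mulf_eq0.

(** Writing [f = f(0) (1 - h)] with [h] of order at least 1, the inverse is the geometric series in
    [h]. Its coefficient of index n is read off a partial sum, since [h ^+ k] has no term of degree
    less than k. *)
Lemma fps_inverse f : f 0%N != 0 -> exists g, f * g = 1 /\ g 0%N = (f 0%N)^-1.
Proof.
move=> f0; pose h := 1 - fpsC (f 0%N)^-1 * f.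
have h0 : ord_ge 1 h.
  by case=> // _; rewrite coef_fpsB coef_fpsCM coef_fps1 mulVf // subrr.
have hX n : ord_ge n (h ^+ n).
  by elim: n => // n IHn; rewrite exprS -add1n; apply: ord_geM.
pose S n := \sum_(k < n) h ^+ k.
pose g := Fps (fun n => S n.+1 n).
have gS n k : (k < n)%N -> g k = S n k.
  move=> lt_kn; rewrite /= -(subnKC lt_kn) /S big_split_ord coef_fpsD.
  rewrite [X in _ + X](_ : _ = 0) ?addr0 // coef_fps_sum big1 // => i _.
  by rewrite hX //=; lia.
have hg : (1 - h) * g = 1.
  apply: fpsP => n; transitivity (((1 - h) * S n.+1) n).
    by rewrite !coef_fpsM; apply: eq_bigr => -[k ltk] _; rewrite (gS n.+1) //; lia.
  have -> : (1 - h) * S n.+1 = 1 - h ^+ n.+1.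
    have := subrXX 1 h n.+1; rewrite expr1n => ->; congr (_ * _).
    by apply: eq_bigr => i _; rewrite expr1n mul1r.
  by rewrite coef_fpsB hX // subr0.
exists (fpsC (f 0%N)^-1 * g); split; last first.
  by rewrite coef_fpsCM /= /S big_ord1 expr0 coef_fps1 mulr1.
by rewrite mulrA [f * _]mulrC -hg /h opprB addrC subrK.
Qed.

End FpsDomain.

(** * Evaluation of polynomials, the chain rule, and generic points of cones *)

Section MpolyEvaluation.

Lemma mpoly_ring_ind (n : nat) (K : comNzRingType) (P : {mpoly K[n]} -> Prop) :
  (forall c, P c%:MP) -> (forall i, P 'X_i) ->
  (forall F G, P F -> P G -> P (F + G)) ->
  (forall F G, P F -> P G -> P (F * G)) -> forall F, P F.
Proof.
move=> PC PX PD PM F; rewrite [F]mpolyE; elim/big_ind: _ => //.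
  by rewrite -mpolyC0.
move=> m _; rewrite -mul_mpolyC mpolyXE_id; apply: (PM) => //.
elim/big_ind: _ => // [|i _]; first by rewrite -mpolyC1.
elim: (m i) => [|k IHk]; first by rewrite expr0 -mpolyC1.
by rewrite exprS; apply: PM.
Qed.

Lemma rmorph_mmap (n : nat) (K A B : comNzRingType) (f : {rmorphism A -> B})
    (phi : {rmorphism K -> A}) (v : 'I_n -> A) (F : {mpoly K[n]}) :
  f (mmap phi v F) = mmap (f \o phi) (f \o v) F.
Proof.
rewrite /mmap rmorph_sum; apply: eq_bigr => m _.
by rewrite rmorphM rmorph_prod; under eq_bigr do rewrite rmorphXn.
Qed.

Lemma eq_mmap (n : nat) (K A : comNzRingType) (phi : K -> A)
    (v w : 'I_n -> A) (F : {mpoly K[n]}) : v =1 w -> mmap phi v F = mmap phi w F.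
Proof.
by move=> vw; apply: eq_bigr => m _; congr (_ * _); apply: mmap1_eq.
Qed.

Lemma mmap_comp (n k : nat) (K A : comNzRingType) (phi : {rmorphism K -> A})
    (v : 'I_n -> A) (f : k.-tuple {mpoly K[n]}) (P : {mpoly K[k]}) :
  mmap phi v (P \mPo f) = mmap phi (fun i => mmap phi v (tnth f i)) P.
Proof.
rewrite /comp_mpoly rmorph_mmap; apply: eq_bigr => m _.
by rewrite /= mmapC.
Qed.

(** The chain rule for a derivation killing the constants. It is used for the derivative in the cone
    variable, for the derivative in [u], and for partial derivatives of a composite. *)
Lemma mmap_derivation (n : nat) (K A : comNzRingType) (phi : {rmorphism K -> A})
    (v : 'I_n -> A) (d : {additive A -> A}) :
  (forall x y, d (x * y) = d x * y + x * d y) -> (forall c, d (phi c) = 0) ->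
  forall F : {mpoly K[n]},
  d (mmap phi v F) = \sum_i mmap phi v F^`M(i) * d (v i).
Proof.
move=> dM dphi; elim/mpoly_ring_ind => [c|i|F G IHF IHG|F G IHF IHG].
- by rewrite mmapC dphi big1 // => i _; rewrite mderivC raddf0 mul0r.
- rewrite mmapX mmap1U (bigD1 i) //= big1 ?addr0 => [|j ne_ji].
    rewrite mderivX mnm1E eqxx scale1r.
    by rewrite (_ : (U_(i) - U_(i))%MM = 0%MM) ?mpolyX0 ?rmorph1 ?mul1r //;
      apply/mnmP => j; rewrite !mnmE subnn.
  by rewrite mderivX mnm1E eq_sym (negbTE ne_ji) scale0r raddf0 mul0r.
- rewrite !raddfD /= IHF IHG -big_split /=; apply: eq_bigr => i _.
  by rewrite mderivD raddfD /= mulrDl.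
- rewrite rmorphM dM IHF IHG mulr_suml mulr_sumr -big_split /=.
  apply: eq_bigr => i _; rewrite mderivM raddfD /= !rmorphM /=; ring.
Qed.

(* The generic point [v 'X] of the line through [v]: an ideal is homogeneous
   as soon as it consists of polynomials vanishing at such points. *)
Definition cone_eval (n : nat) (K A : comNzRingType) (phi : K -> A)
    (v : 'I_n -> A) : {mpoly K[n]} -> {poly A} :=
  mmap (polyC \o phi) (fun i => (v i)%:P * 'X).

Section ConeEval.
Variables (n : nat) (K A : comNzRingType) (phi : {rmorphism K -> A}).
Variable v : 'I_n -> A.
Implicit Types F G : {mpoly K[n]}.
Local Notation T := (cone_eval phi v).

Lemma cone_eval_is_zmod_morphism : zmod_morphism T.
Proof. exact: raddfB. Qed.

Lemma cone_eval_is_monoid_morphism : monoid_morphism T.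
Proof. by split; [exact: rmorph1 | exact: rmorphM]. Qed.

HB.instance Definition _ :=
  GRing.isZmodMorphism.Build {mpoly K[n]} {poly A} T cone_eval_is_zmod_morphism.
HB.instance Definition _ :=
  GRing.isMonoidMorphism.Build {mpoly K[n]} {poly A} T
    cone_eval_is_monoid_morphism.

Lemma coef_cone_eval F d : (T F)`_d = mmap phi v (pihomog mdeg d F).
Proof.
rewrite /cone_eval pihomogE raddf_sum /= {1}/mmap coef_sum [RHS]big_mkcond /=.
apply: eq_bigr => m _; rewrite coefCM mmapZ mmapX /mmap1.
under eq_bigr do rewrite exprMn -rmorphXn.
rewrite big_split -rmorph_prod prodrXr -mdegE coefCM coefXn eq_sym.
by case: eqP => _; rewrite ?mulr1 ?mulr0.
Qed.

Lemma cone_eval_homog F d :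
  F \is d.-homog -> T F = (mmap phi v F)%:P * 'X^d.
Proof.
move=> hF; apply/polyP => k; rewrite coef_cone_eval coefCM coefXn.
have [->|ne] := eqVneq k d; first by rewrite pihomog_dE ?mulr1.
by rewrite (pihomog_ne0 _ hF) 1?eq_sym // raddf0 mulr0.
Qed.

Lemma horner_cone_eval F x : (T F).[x] = mmap phi (fun i => v i * x) F.
Proof.
rewrite /cone_eval -[_.[x]]/(horner_eval x _) rmorph_mmap.
apply: eq_bigr => m _; rewrite /= /horner_eval hornerC; congr (_ * _).
by apply: mmap1_eq => i /=; rewrite /horner_eval hornerCM hornerX.
Qed.

Lemma cone_eval_comp k (f : k.-tuple {mpoly K[n]}) (P : {mpoly K[k]}) :
  T (P \mPo f) = mmap (polyC \o phi) (fun i => T (tnth f i)) P.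
Proof. exact: mmap_comp. Qed.

(** Euler's relation in all degrees at once: the derivative in the cone variable replaces
    multiplication by the degree. *)
Lemma cone_eval_euler F : (T F)^`() = \sum_i T F^`M(i) * (v i)%:P.
Proof.
rewrite /cone_eval (@mmap_derivation _ _ _ _ _ (@deriv A)).
- by apply: eq_bigr => i _; rewrite /= derivM derivC derivX mul0r add0r mulr1.
- exact: derivM.
- by move=> c; rewrite /= derivC.
Qed.

(** Applied coefficientwise, [d] is a derivation of [{poly A}] for which the cone variable is a
    constant. *)
Lemma cone_eval_derivation (d : {additive A -> A}) F :
  (forall x y, d (x * y) = d x * y + x * d y) -> (forall c, d (phi c) = 0) ->
  map_poly d (T F) = \sum_i T F^`M(i) * ((d (v i))%:P * 'X).
Proof.
move=> dM dphi; rewrite /cone_eval (@mmap_derivation _ _ _ _ _ (map_poly d)).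
- apply: eq_bigr => i _; congr (_ * _); apply/polyP => k.
  by rewrite coef_map !coefMX !coefC /=; case: k => [|[|k]] //=; rewrite raddf0.
- move=> p q; apply/polyP => k; rewrite coef_map coefM raddf_sum coefD !coefM.
  by rewrite -big_split; apply: eq_bigr => i _; rewrite dM !coef_map.
- by move=> c /=; rewrite map_polyC /= dphi.
Qed.

End ConeEval.
End MpolyEvaluation.

Lemma ord3P (T : Type) (op : T -> T -> T) (idx : T) (F : 'I_3 -> T) :
  \big[op/idx]_(i < 3) F i = op (F 0) (op (F 1) (op (F 2%:R) idx)).
Proof.
rewrite !big_ord_recl big_ord0.
have -> : lift ord0 ord0 = 1 :> 'I_3 by apply: val_inj.
by have -> : lift ord0 (lift ord0 ord0) = 2%:R :> 'I_3 by apply: val_inj.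
Qed.

(** * The ideal of a projective algebraic set *)

Section CurveIdeal.
Variable K : fieldType.
Hypothesis pcharK : [pchar K] =i pred0.
Implicit Types (X Y : 'rV[K]_4 -> Prop) (F G : {mpoly K[4]}) (v : 'rV[K]_4).

Let natK n : (n%:R == 0 :> K) = (n == 0%N).
Proof. by move/pcharf0P: pcharK. Qed.

Definition line_eval v : {mpoly K[4]} -> {poly K} := cone_eval idfun (v 0).

Lemma poly_nat_roots (p : {poly K}) :
  (forall n : nat, (0 < n)%N -> p.[n%:R] = 0) -> p = 0.
Proof.
move=> p0; apply/eqP; apply: contraT => nz_p.
have := @max_poly_roots _ p [seq n%:R | n <- iota 1 (size p)] nz_p.
rewrite size_map size_iota ltnn; apply.
  by apply/allP => _ /mapP[n + ->]; rewrite mem_iota => /andP[n0 _]; apply/eqP/p0.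
rewrite map_inj_in_uniq ?iota_uniq // => m n _ _ /eqP.
wlog le_nm : m n / (n <= m)%N.
  by move=> W; case/orP: (leq_total n m) => [/W//|/W le]; rewrite eq_sym => /le.
by rewrite -subr_eq0 -natrB // natK subn_eq0 => le_mn; apply/anti_leq/andP.
Qed.

Lemma line_eval_scale v F x : (line_eval v F).[x] = F.@[(x *: v) 0].
Proof.
rewrite horner_cone_eval; apply: eq_mmap => i.
by rewrite mxE mulrC.
Qed.

Lemma coef_line_eval v F d : (line_eval v F)`_d = (pihomog mdeg d F).@[v 0].
Proof. exact: coef_cone_eval. Qed.

Lemma closed_neq0 X v : zariski_closed X -> X v -> v != 0.
Proof. by move=> clX /clX[]. Qed.

Lemma closed_scale X v x : zariski_closed X -> x != 0 -> X v -> X (x *: v).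
Proof.
move=> clX x0 Xv; apply/clX; split=> [|d F hF vF].
  by rewrite scaler_eq0 negb_or x0 (closed_neq0 clX).
by rewrite -line_eval_scale /line_eval (cone_eval_homog _ _ hF) hornerCM [mmap _ _ _]vF ?mul0r.
Qed.

(** A closed set contains the multiples of its vectors by all positive integers, which are
    infinitely many scalars in characteristic 0. The ideal of the set is therefore homogeneous. *)
Lemma vanishes_line X F v :
  zariski_closed X -> vanishes X F -> X v -> line_eval v F = 0.
Proof.
move=> clX vF Xv; apply: poly_nat_roots => n n0.
by rewrite line_eval_scale vF //; apply: closed_scale; rewrite // natK -lt0n.
Qed.

Lemma vanishes_lineP X F :
  zariski_closed X -> (vanishes X F <-> forall v, X v -> line_eval v F = 0).
Proof.
move=> clX; split=> [vF v|vF v Xv]; first exact: vanishes_line.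
by rewrite -[v]scale1r -line_eval_scale vF ?horner0.
Qed.

Lemma vanishes_pihomog X F d :
  zariski_closed X -> vanishes X F -> vanishes X (pihomog mdeg d F).
Proof.
by move=> clX vF v Xv; rewrite -coef_line_eval (vanishes_line clX) // coef0.
Qed.

(** For an inhomogeneous [F], vanishing on the whole line through [v] means that every homogeneous
    component vanishes at [v]; this is the closed condition. *)
Lemma line_eval_closed X F :
  zariski_closed X -> zariski_closed (fun v => X v /\ line_eval v F = 0).
Proof.
move=> clX v; split=> [[Xv Fv]|[v0 cl_v]].
  by split=> [|d G _ vG]; [exact: closed_neq0 Xv | exact: vG].
split; first by apply/clX; split=> // d G hG vG; apply: cl_v hG _ => w [/vG].
apply/polyP => d; rewrite coef_line_eval coef0.
by apply: cl_v (pihomogP _ _ _) _ => w [_ Fw]; rewrite -coef_line_eval Fw coef0.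
Qed.

Lemma vanishes_prime X F G :
  irreducible_closed X -> vanishes X (F * G) -> vanishes X F \/ vanishes X G.
Proof.
move=> [clX _ irrX] vFG.
have cover v : X v ->
    (X v /\ line_eval v F = 0) \/ (X v /\ line_eval v G = 0).
  move=> Xv; have /eqP := vanishes_line clX vFG Xv.
  by rewrite /line_eval rmorphM mulf_eq0 => /orP[] /eqP; [left|right].
have [XFG|XFG] := irrX _ _ (line_eval_closed F clX) (line_eval_closed G clX) cover.
- by left; apply/vanishes_lineP => // v /XFG[].
- by right; apply/vanishes_lineP => // v /XFG[].
Qed.

(** * Branches are generic points of irreducible curves *)

Definition branch_eval (beta : 'rV[fps K]_4) : {mpoly K[4]} -> {poly fps K} :=
  cone_eval (@fpsC K) (beta 0).

HB.instance Definition _ beta :=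
  GRing.RMorphism.copy (branch_eval beta) (cone_eval (@fpsC K) (beta 0)).

Lemma branch_evalC beta c : branch_eval beta c%:MP = (fpsC c)%:P.
Proof. by rewrite /branch_eval /cone_eval mmapC. Qed.

Lemma branch_evalX beta i : branch_eval beta 'X_i = (beta 0 i)%:P * 'X.
Proof. by rewrite /branch_eval /cone_eval mmapX mmap1U. Qed.

Lemma branch_evalZX beta c i :
  branch_eval beta (c *: 'X_i) = (beta 0 i * fpsC c)%:P * 'X.
Proof.
rewrite -mul_mpolyC rmorphM [_ c%:MP]branch_evalC [_ 'X_i]branch_evalX mulrA.
by rewrite -polyCM [_ * fpsC c]mulrC.
Qed.

Lemma lies_on_branch X beta F :
  zariski_closed X -> lies_on X beta -> vanishes X F -> branch_eval beta F = 0.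
Proof.
move=> clX onX vF; apply/polyP => d; rewrite coef_cone_eval coef0.
by apply: (onX d); [exact: pihomogP | exact: vanishes_pihomog].
Qed.

(** At [u = 0] the value is the constant term of [p], which is thus 0; then a factor [a] cancels and
    induction applies. *)
Lemma poly_fps_transcendental (a : fps K) (p : {poly K}) :
  ord_ge 1 a -> a != 0 -> (map_poly (@fpsC K) p).[a] = 0 -> p = 0.
Proof.
move=> a1 a0; elim/poly_ind: p => // p c IHp.
rewrite rmorphD rmorphM /= map_polyX map_polyC /= hornerMXaddC => pa.
have c0 : c = 0.
  move/(congr1 (fun f : fps K => f 0%N)): pa.
  by rewrite coef_fpsD coef_fps0 (ord_geMl _ a1) // add0r.
move/eqP: pa; rewrite c0 rmorph0 addr0 mulf_eq0 (negbTE a0) orbF => /eqP/IHp->.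
by rewrite mul0r add0r polyC0.
Qed.

(** Either alternative of the last hypothesis reduces [P] to its monomials free of the first
    variable. In degree d these give [l^d p(a)], where [p] is a dehomogenization, nonzero because of
    [m], and [a] is transcendental. *)
Lemma cone_eval_indep (v : 'I_3 -> fps K) (a l : fps K) (P : {mpoly K[3]}) m :
  ord_ge 1 a -> a != 0 -> l != 0 -> v 1 = l * a -> v 2%:R = l ->
  m \in msupp P -> m 0 = 0%N ->
  (v 0 = 0 \/ forall m', m' \in msupp P -> m' 0 = 0%N) ->
  cone_eval (@fpsC K) v P != 0.
Proof.
move=> a1 a0 l0 v1 v2 mP m0 v0; set d := mdeg m.
apply/eqP => /(congr1 (fun p : {poly fps K} => p`_d)).
rewrite coef_cone_eval coef0 pihomogE raddf_sum /=.
pose p : {poly K} := \sum_(m' <- msupp P | (mdeg m' == d) && (m' 0 == 0%N))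
  P@_m' *: 'X^(m' 1).
have mdeg3 (m' : 'X_{1..3}) : mdeg m' = (m' 0%R + (m' 1%R + m' 2%:R))%N.
  by rewrite mdegE ord3P addn0.
have -> : \sum_(i <- msupp P | mdeg i == d) mmap (@fpsC K) v (P@_i *: 'X_[i])
    = l ^+ d * (map_poly (@fpsC K) p).[a].
  rewrite /p big_mkcondr rmorph_sum.
  rewrite horner_sum mulr_sumr big_seq_cond [RHS]big_seq_cond.
  apply: eq_bigr => m' /andP[m'P /eqP dm']; rewrite mmapZ mmapX /mmap1.
  rewrite ord3P mulr1 v1 v2; have [m'0|nz_m'0] := eqVneq (m' 0) 0%N.
    rewrite m'0 expr0 mul1r -mul_polyC rmorphM /= map_polyC map_polyXn hornerCM hornerXn.
    by rewrite -dm' mdeg3 m'0 add0n exprD exprMn [RHS]mulrCA [l ^+ _ * _ * _]mulrAC.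
  rewrite rmorph0 horner0 mulr0; case: v0 => [->|/(_ m' m'P)]; last first.
    by move/eqP; rewrite (negbTE nz_m'0).
  by rewrite expr0n (negbTE nz_m'0) mul0r mulr0.
move/eqP; rewrite mulf_eq0 expf_eq0 (negbTE l0) andbF /= => /eqP.
move/(poly_fps_transcendental a1 a0)/(congr1 (fun q : {poly K} => q`_(m 1))).
rewrite coef0 coef_sum big_mkcond (bigD1_seq m) ?msupp_uniq //= big1_seq => [|m'].
  rewrite eqxx m0 eqxx coefZ coefXn eqxx mulr1 addr0 => /eqP.
  by move: mP; rewrite mcoeff_msupp => /negbTE->.
case/andP=> ne_m' m'P; case: andP => // -[/eqP dm' /eqP m'0].
rewrite coefZ coefXn; case: eqP => [m1|]; rewrite ?mulr0 //; case/eqP: ne_m'.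
have m2 : m' 2%:R = m 2%:R by move: dm'; rewrite /d !mdeg3 m'0 m0 m1; lia.
apply/mnmP => -[[|[|[|//]]] lti].
- by rewrite (_ : Ordinal lti = 0) ?m'0 ?m0 //; apply: val_inj.
- by rewrite (_ : Ordinal lti = 1) ?m1 //; apply: val_inj.
- by rewrite (_ : Ordinal lti = 2%:R) ?m2 //; apply: val_inj.
Qed.

End CurveIdeal.

(** * Equations of the curve and their gradients along a branch *)

Section GenericPoint.
Variable K : fieldType.
Hypothesis pcharK : [pchar K] =i pred0.
Variables (X : 'rV[K]_4 -> Prop) (beta : 'rV[fps K]_4).
Hypotheses (curveX : irreducible_curve X) (onX : lies_on X beta).
Variables (M : 'M[K]_4) (l : fps K) (alpha : 'rV[fps K]_4).
Hypotheses (nz_l : l != 0) (betaM : beta *m map_mx (@fpsC K) M = l *: alpha).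
Hypotheses (alpha0 : ord_ge 1 (alpha 0 0)) (nz_alpha0 : alpha 0 0 != 0).
Hypothesis alpha3 : alpha 0 ord_max = 1.
Implicit Types (F G : {mpoly K[4]}) (P : {mpoly K[3]}).

Local Notation T := (branch_eval beta).

Let irrX : irreducible_closed X. Proof. by case: curveX. Qed.
Let clX : zariski_closed X. Proof. by case: irrX. Qed.

Definition coord_form (j : 'I_4) : {mpoly K[4]} := \sum_i M i j *: 'X_i.

Lemma branch_coord_form j : T (coord_form j) = (l * alpha 0 j)%:P * 'X.
Proof.
rewrite /T raddf_sum /=.
have -> : l * alpha 0 j = \sum_i beta 0 i * fpsC (M i j).
  transitivity ((l *: alpha) 0 j); first by rewrite mxE.
  by rewrite -betaM mxE; apply: eq_bigr => i _; rewrite mxE.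
rewrite rmorph_sum mulr_suml; apply: eq_bigr => i _.
exact: branch_evalZX.
Qed.

(** Three elements of a ring of transcendence degree 2 are dependent, whereas the last two are
    independent already on the branch, where their values are [l * alpha 0 0] and [l] times the cone
    variable. *)
Definition dependence_tuple F : 3.-tuple {mpoly K[4]} :=
  [tuple F; coord_form 0; coord_form ord_max].

Lemma branch_comp F P : T (P \mPo dependence_tuple F) =
  mmap (polyC \o @fpsC K) (fun i => T (tnth (dependence_tuple F) i)) P.
Proof. exact: cone_eval_comp. Qed.

Lemma branch_comp_neq0 F (t : fps K) P m : T F = t%:P * 'X ->
  m \in msupp P -> m 0 = 0%N ->
  (t = 0 \/ forall m', m' \in msupp P -> m' 0 = 0%N) ->
  T (P \mPo dependence_tuple F) != 0.
Proof.
move=> TF mP m0 t0; rewrite branch_comp.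
pose v (i : 'I_3) := tnth [tuple t; l * alpha 0 0; l] i.
have -> : mmap (polyC \o @fpsC K) (fun i => T (tnth (dependence_tuple F) i)) P
    = cone_eval (@fpsC K) v P.
  apply: eq_mmap => -[[|[|[|//]]] lti]; rewrite /v !(tnth_nth 0) /=.
  - exact: TF.
  - exact: branch_coord_form.
  - by rewrite branch_coord_form alpha3 mulr1.
exact: (@cone_eval_indep _ _ (alpha 0 0) l P m).
Qed.

(** If [F] did not vanish on the curve, the tuple would be independent. A relation with a monomial
    free of the first variable would restrict on the branch, where [F] is 0, to a nontrivial
    relation between the two coordinates. Otherwise the first variable is a factor of the relation,
    and primality of the ideal allows [F] to be cancelled. *)
Lemma branch_generic F : T F = 0 -> vanishes X F.
Proof.
move=> TF; case: (pselect (vanishes X F)) => // nvF; case: curveX => _ [_ dep].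
case: (dep (dependence_tuple F)) => P; have [n] := ubnP (msize P).
elim: n P => // n IHn P lt_n vP.
case: (pselect (exists2 m, m \in msupp P & m 0 = 0%N)) => [[m mP m0]|noP].
  have TF' : T F = 0%:P * 'X by rewrite TF polyC0 mul0r.
  have := branch_comp_neq0 TF' mP m0 (or_introl erefl).
  by rewrite (lies_on_branch pcharK clX onX vP) eqxx.
pose R : {mpoly K[3]} := \sum_(m <- msupp P) P@_m *: 'X_[m - U_(0)].
have PR : P = 'X_0 * R.
  rewrite mulr_sumr {1}[P]mpolyE big_seq [RHS]big_seq; apply: eq_bigr => m mP.
  rewrite -scalerAr -mpolyXD addmC submK //; apply/mnm_lepP => i.
  rewrite mnm1E; case: eqP => // <-; rewrite lt0n; apply/eqP => m0.
  by apply: noP; exists m.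
have [R0|nzR] := eqVneq R 0; first by rewrite PR R0 mulr0.
have ltR : (msize R < n)%N.
  have nzX : 'X_0 != 0 :> {mpoly K[3]} by rewrite -msize_poly_eq0 msizeX.
  have : (0 < msize R)%N by rewrite lt0n msize_poly_eq0.
  move: lt_n; rewrite PR (msizeM nzX nzR) msizeX mdeg1 => ltR _; exact: ltR.
suff /(IHn _ ltR) R0 : vanishes X (R \mPo dependence_tuple F) by rewrite R0 eqxx in nzR.
move: vP; rewrite PR rmorphM /= comp_mpolyXU => /(vanishes_prime pcharK irrX).
by case.
Qed.

Lemma mderiv_coord_form i j : (coord_form j)^`M(i) = (M i j)%:MP.
Proof.
rewrite raddf_sum (bigD1 i) //= big1 => [|k ne_ki].
  rewrite mderivZ mderivX mnm1E eqxx scale1r addr0.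
  rewrite (_ : (U_(i) - U_(i))%MM = 0%MM) ?mpolyX0.
    by rewrite -mul_mpolyC mulr1.
  by apply/mnmP => j'; rewrite !mnmE subnn.
by rewrite mderivZ mderivX mnm1E (negbTE ne_ki) scale0r scaler0.
Qed.

Lemma msize_mderiv n (R : idomainType) (P : {mpoly R[n]}) i k :
  (msize P <= k.+1)%N -> (msize P^`M(i) <= k)%N.
Proof.
move=> le_k; rewrite msizeE; apply/bigmax_leqP_seq => m.
rewrite mcoeff_msupp mcoeff_deriv => Pm _.
have /msize_mdeg_lt : (m + U_(i))%MM \in msupp P.
  by rewrite mcoeff_msupp; apply: contraNneq Pm => ->; rewrite mul0rn.
by rewrite mdegD mdeg1 addn1 => /leq_trans/(_ le_k); rewrite ltnS.
Qed.

(* In characteristic 0, a relation of least degree satisfied by a function over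
   a transcendence basis is separable. *)
Lemma branch_separable F (t : fps K) : T F = t%:P * 'X ->
  exists P, vanishes X (P \mPo dependence_tuple F) /\
            T (P^`M(0) \mPo dependence_tuple F) != 0.
Proof.
move=> TF; case: curveX => _ [_ dep].
have [P] : exists P, P != 0 /\ vanishes X (P \mPo dependence_tuple F).
  apply: contrapT => noP; apply: (dep (dependence_tuple F)) => P vP.
  by apply/eqP; apply: contrapT => nzP; apply: noP; exists P; split=> //; apply/negP.
have [n] := ubnP (msize P); elim: n P => // n IHn P; rewrite ltnS => le_n [nzP vP].
set dT := T (P^`M(0) \mPo dependence_tuple F).
have [dP0|/eqP nz_dP] := pselect (dT = 0); last first.
  by exists P; split; [exact: vP | exact: nz_dP].
have [d0|nz_d] := eqVneq P^`M(0) 0; last first.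
  case: n IHn le_n => [|n] IHn le_n.
    by move: nzP; rewrite -msize_poly_eq0 -leqn0 le_n.
  apply: (IHn P^`M(0)); last by split; [exact: nz_d | exact: branch_generic].
  by rewrite ltnS; apply: msize_mderiv.
have m0 m : m \in msupp P -> m 0 = 0%N.
  rewrite mcoeff_msupp => mP; apply/eqP; apply: contraNT mP => nz_m0.
  have := congr1 (mcoeff (m - U_(0%R))%MM) d0; rewrite mcoeff_deriv mcoeff0.
  rewrite submK => [/eqP|]; last first.
    by apply/mnm_lepP => i; rewrite mnm1E; case: eqP => // <-; rewrite lt0n.
  by rewrite -mulr_natr mulf_eq0 ((pcharf0P K).1 pcharK) orbF.
have mP : mlead P \in msupp P by apply: mlead_supp.
have := branch_comp_neq0 TF mP (m0 _ mP) (or_intror m0).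
by rewrite (lies_on_branch pcharK clX onX vP) eqxx.
Qed.

(** The chain rule applied to a separable relation between the coordinates [j], 0 and 3;
    separability is what gives [a != 0]. For [j = 1] and [j = 2] the two gradients are independent
    modulo the coordinate covectors 0 and 3. *)
Lemma branch_jacobian j : exists F a b c,
  [/\ vanishes X F, a != 0 & forall i,
   T F^`M(i) = a * (fpsC (M i j))%:P + b * (fpsC (M i 0))%:P
             + c * (fpsC (M i ord_max))%:P].
Proof.
have [P [vP nzP]] := branch_separable (branch_coord_form j).
set f := dependence_tuple (coord_form j) in vP nzP.
exists (P \mPo f), (T (P^`M(0) \mPo f)), (T (P^`M(1) \mPo f)),
  (T (P^`M(2%:R) \mPo f)); split=> // i.
rewrite /comp_mpoly (@mmap_derivation _ _ _ _ _ (mderiv i)) => [|p q|c].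
- rewrite ord3P /= addr0 !(tnth_nth 0) /= !mderiv_coord_form.
  by rewrite !rmorphD !rmorphM /= !branch_evalC addrA.
- exact: mderivM.
- exact: mderivC.
Qed.

End GenericPoint.

(** * The vector product of three covectors in dimension 4 *)

Section CrossProduct.
Variable A : comNzRingType.
Implicit Types x f g h p : 'I_4 -> A.

Definition dot f p : A := \sum_i f i * p i.

Definition stack x f g h : 'M[A]_4 :=
  \matrix_(i, j) nth x [:: x; f; g; h] i j.

(** The coefficients of the linear form [x |-> det (x, f, g, h)]. *)
Definition cross f g h (j : 'I_4) : A := cofactor (stack f f g h) 0 j.

Lemma cofactor_stack x f g h j : cofactor (stack x f g h) 0 j = cross f g h j.
Proof.
congr (_ * \det _); apply/matrixP => i k; rewrite !mxE /=.
by case: i => -[|[|[|//]]].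
Qed.

Lemma det_stack x f g h : \det (stack x f g h) = dot x (cross f g h).
Proof.
by rewrite (expand_det_row _ 0); apply: eq_bigr => j _; rewrite cofactor_stack mxE.
Qed.

Lemma dot_crossr f g h : dot h (cross f g h) = 0.
Proof.
rewrite -det_stack (@determinant_alternate _ _ _ 0 (Ordinal (isT : 3 < 4)%N)) // => j.
by rewrite !mxE.
Qed.

(** Cramer's rule over a commutative ring, hence stated by cross-multiplication. The matrix with
    rows [e_i], [f], [g], [h] sends [p] to [p i] times the first basis vector; its adjugate sends
    this back to [p] times the determinant, which is [cross f g h i]. *)
Lemma cross_unique f g h p i j :
  dot f p = 0 -> dot g p = 0 -> dot h p = 0 ->
  p i * cross f g h j = p j * cross f g h i.
Proof.
move=> fp gp hp; pose e k : A := (k == i)%:R.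
pose N := stack e f g h; pose P : 'cV[A]_4 := \col_k p k.
have NP : N *m P = p i *: delta_mx 0 0.
  apply/colP => k; rewrite !mxE.
  have -> : \sum_j0 N k j0 * P j0 0 = dot (nth e [:: e; f; g; h] k) p.
    by apply: eq_bigr => j0 _; rewrite !mxE.
  case: k => -[|[|[|[|//]]]] ltk /=; rewrite ?mulr0 ?mulr1 //.
  by rewrite /dot (bigD1 i) //= big1 => [|k /negbTE ne]; rewrite /e ?ne ?mul0r // eqxx mul1r addr0.
have := congr1 (fun B : 'cV[A]_4 => B j 0) (mulmxA (\adj N) N P).
rewrite NP mul_adj_mx mul_scalar_mx -scalemxAr -colE !mxE cofactor_stack => ->.
rewrite mulrC det_stack /dot (bigD1 i) //= big1 => [|k /negbTE ne].
  by rewrite /e eqxx mul1r addr0.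
by rewrite /e ne mul0r.
Qed.

End CrossProduct.

Lemma rmorph_dot (A B : comNzRingType) (phi : {rmorphism A -> B}) (f p : 'I_4 -> A) :
  phi (dot f p) = dot (phi \o f) (phi \o p).
Proof. by rewrite rmorph_sum; apply: eq_bigr => i _; rewrite rmorphM. Qed.

Lemma rmorph_cross (A B : comNzRingType) (phi : {rmorphism A -> B})
    (f g h : 'I_4 -> A) j :
  phi (cross f g h j) = cross (phi \o f) (phi \o g) (phi \o h) j.
Proof.
rewrite /cross -cofactor_map_mx; congr (cofactor _ _ _).
by apply/matrixP => -[[|[|[|[|//]]]] lti] k; rewrite !mxE.
Qed.

(** * Bilinear forms and Gram matrices of quadrics *)

Section QuadraticForms.
Variable A : comNzRingType.
Implicit Types (S : 'M[A]_4) (v w : 'rV[A]_4).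

Definition bilinear_mx S v w : A := (v *m S *m w^T) 0 0.

Lemma bilinear_mxDl S v1 v2 w :
  bilinear_mx S (v1 + v2) w = bilinear_mx S v1 w + bilinear_mx S v2 w.
Proof. by rewrite /bilinear_mx !mulmxDl mxE. Qed.

Lemma bilinear_mxDr S v w1 w2 :
  bilinear_mx S v (w1 + w2) = bilinear_mx S v w1 + bilinear_mx S v w2.
Proof. by rewrite /bilinear_mx linearD mulmxDr mxE. Qed.

Lemma bilinear_mxZl S x v w : bilinear_mx S (x *: v) w = x * bilinear_mx S v w.
Proof. by rewrite /bilinear_mx -!scalemxAl mxE. Qed.

Lemma bilinear_mxZr S x v w : bilinear_mx S v (x *: w) = x * bilinear_mx S v w.
Proof. by rewrite /bilinear_mx linearZ -scalemxAr mxE. Qed.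

Lemma bilinear_mxC S v w : S^T = S -> bilinear_mx S v w = bilinear_mx S w v.
Proof.
move=> symS; transitivity ((v *m S *m w^T)^T 0 0); first by rewrite mxE.
by rewrite 2!trmx_mul trmxK symS mulmxA.
Qed.

Lemma bilinear_mx_dot S v w : bilinear_mx S v w = dot ((v *m S) 0) (w 0).
Proof. by rewrite /bilinear_mx mxE; apply: eq_bigr => i _; rewrite [w^T _ _]mxE. Qed.

End QuadraticForms.

Section Quadrics.
Variable K : fieldType.
Hypothesis pcharK : [pchar K] =i pred0.

Definition monomial_mx (k : 'I_10) : 'M[K]_4 :=
  let ij := nth (ord0, ord0) quadric_monomials k in
  2%:R^-1 *: (delta_mx ij.1 ij.2 + delta_mx ij.2 ij.1).

Definition gram (q : 'rV[K]_10) : 'M[K]_4 := \sum_k q 0 k *: monomial_mx k.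

Lemma gram_sym q : (gram q)^T = gram q.
Proof.
rewrite raddf_sum; apply: eq_bigr => k _.
rewrite /monomial_mx; case: (nth _ _ k) => i j /=.
by do 2!rewrite linearZ /=; rewrite linearD /= !trmx_delta addrC.
Qed.

Lemma bilinear_delta (A : comNzRingType) (v w : 'rV[A]_4) i j :
  bilinear_mx (delta_mx i j) v w = v 0 i * w 0 j.
Proof.
rewrite bilinear_mx_dot /dot (bigD1 j) //= big1 => [|k ne_kj].
  rewrite mxE (bigD1 i) //= big1 => [|k ne_ki]; first by rewrite mxE !eqxx mulr1 !addr0.
  by rewrite mxE (negbTE ne_ki) mulr0.
rewrite mxE big1 ?mul0r // => l _.
by rewrite mxE (negbTE ne_kj) andbF mulr0.
Qed.

Lemma two_neq0 : 2%:R != 0 :> K.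
Proof. by rewrite ((pcharf0P K).1 pcharK). Qed.

Section Morphism.
Variables (A : comNzRingType) (phi : {rmorphism K -> A}).
Implicit Types v w : 'rV[A]_4.

Lemma mmap_quadric q v :
  mmap phi (v 0) (quadric q) = bilinear_mx (map_mx phi (gram q)) v v.
Proof.
rewrite /bilinear_mx raddf_sum /= (raddf_sum (map_mx phi)) /=.
rewrite mulmx_sumr mulmx_suml summxE; apply: eq_bigr => k _.
rewrite mmapZ rmorphM /= !mmapX !mmap1U map_mxZ -scalemxAr -scalemxAl mxE.
congr (_ * _); rewrite /monomial_mx; case: (nth _ _ k) => i j /=.
rewrite map_mxZ map_mxD !map_delta_mx -scalemxAr -scalemxAl mxE.
rewrite -[_ 0 0]/(bilinear_mx _ _ _) [bilinear_mx _ _ _](_ : _ = 2%:R * (v 0 i * v 0 j)).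
  by rewrite mulrA -(rmorph_nat phi) -rmorphM mulVf ?two_neq0 // rmorph1 mul1r.
rewrite /bilinear_mx mulmxDr mulmxDl mxE -![_ 0 0]/(bilinear_mx _ _ _).
by rewrite !bilinear_delta [v 0 j * _]mulrC -mulr2n mulr_natl.
Qed.

Lemma quadric_polarization q v w :
  phi 4%:R^-1 * (mmap phi ((v + w) 0) (quadric q)
                 - mmap phi ((v - w) 0) (quadric q))
  = bilinear_mx (map_mx phi (gram q)) v w.
Proof.
have symS : (map_mx phi (gram q))^T = map_mx phi (gram q).
  by rewrite map_trmx gram_sym.
rewrite !mmap_quadric -scaleN1r !bilinear_mxDl !bilinear_mxDr.
rewrite !bilinear_mxZl !bilinear_mxZr (bilinear_mxC w v symS).
set b := bilinear_mx _ v w; rewrite (_ : _ - _ = 4%:R * b); last by ring.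
rewrite mulrA -(rmorph_nat phi) -rmorphM mulVf ?rmorph1 ?mul1r //.
by rewrite ((pcharf0P K).1 pcharK).
Qed.

End Morphism.

Lemma meval_quadric q (v : 'rV[K]_4) :
  (quadric q).@[v 0] = bilinear_mx (gram q) v v.
Proof. by rewrite [LHS](mmap_quadric idfun) map_mx_id. Qed.

Lemma polar_form_quadric q (v w : 'rV[K]_4) :
  polar_form (quadric q) v w = bilinear_mx (gram q) v w.
Proof.
by rewrite /polar_form mulrC [LHS](quadric_polarization idfun) map_mx_id.
Qed.

Lemma halphen_param_quadric q (beta : 'rV[fps K]_4) :
  halphen_param (quadric q) beta =
  bilinear_mx (map_mx (@fpsC K) (gram q)) beta (deriv_param beta) *: beta
  - bilinear_mx (map_mx (@fpsC K) (gram q)) beta beta *: deriv_param beta.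
Proof.
rewrite -(quadric_polarization (@fpsC K)) -(mmap_quadric (@fpsC K)).
by rewrite /halphen_param /polar_form_fps /eval_fps.
Qed.

End Quadrics.

(** * The image branch lies on the Halphen transform *)

Lemma dotDl (A : comNzRingType) (f g p : 'I_4 -> A) :
  dot (fun i => f i + g i) p = dot f p + dot g p.
Proof. by rewrite -big_split; apply: eq_bigr => i _; rewrite mulrDl. Qed.

Lemma dotZl (A : comNzRingType) (x : A) (f p : 'I_4 -> A) :
  dot (fun i => x * f i) p = x * dot f p.
Proof. by rewrite mulr_sumr; apply: eq_bigr => i _; rewrite mulrA. Qed.

Lemma dotC (A : comNzRingType) (f g : 'I_4 -> A) : dot f g = dot g f.
Proof. by apply: eq_bigr => i _; rewrite mulrC. Qed.

Lemma eq_dotl (A : comNzRingType) (f g p : 'I_4 -> A) :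
  f =1 g -> dot f p = dot g p.
Proof. by move=> fg; apply: eq_bigr => i _; rewrite fg. Qed.

Lemma mmap_scale_homog (n : nat) (K A : comNzRingType) (phi : {rmorphism K -> A})
    (v : 'I_n -> A) (c : A) (F : {mpoly K[n]}) d : F \is d.-homog ->
  mmap phi (fun i => c * v i) F = c ^+ d * mmap phi v F.
Proof.
move=> hF; rewrite /mmap mulr_sumr big_seq [RHS]big_seq; apply: eq_bigr => m mF.
rewrite mulrCA; congr (_ * _); rewrite /mmap1; under eq_bigr do rewrite exprMn.
by rewrite big_split prodrXr -mdegE (dhomog_mf hF mF).
Qed.

Section HalphenTransform.
Variable K : fieldType.
Hypothesis pcharK : [pchar K] =i pred0.
Variables (X : 'rV[K]_4 -> Prop) (beta : 'rV[fps K]_4).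
Hypotheses (curveX : irreducible_curve X) (onX : lies_on X beta).
Variables (M : 'M[K]_4) (l : fps K) (alpha : 'rV[fps K]_4).
Hypothesis unitM : M \in unitmx.
Hypotheses (nz_l : l != 0) (betaM : beta *m map_mx (@fpsC K) M = l *: alpha).
Hypotheses (alpha0 : ord_ge 1 (alpha 0 0)) (nz_alpha0 : alpha 0 0 != 0).
Hypothesis alpha3 : alpha 0 ord_max = 1.
Variable q : 'rV[K]_10.
Local Notation S := (gram q).
Local Notation SF := (map_mx (@fpsC K) S).
Hypothesis nz_Qbeta : bilinear_mx SF beta beta != 0.

Local Notation D := {poly fps K}.
Local Notation T := (branch_eval beta).

Let nzX : 'X != 0 :> D. Proof. by rewrite polyX_eq0. Qed.

Let clX : zariski_closed X. Proof. by case: curveX => -[]. Qed.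

Let generic F : T F = 0 -> vanishes X F.
Proof. exact: (branch_generic pcharK curveX onX nz_l betaM alpha0 nz_alpha0 alpha3). Qed.

Definition const_row (v : 'rV[fps K]_4) (i : 'I_4) : D := (v 0 i)%:P.
Definition branch_grad (F : {mpoly K[4]}) (i : 'I_4) : D := T F^`M(i).

Lemma grad_branch F : vanishes X F -> dot (branch_grad F) (const_row beta) = 0.
Proof.
move=> vF; rewrite -[RHS](deriv0) -(lies_on_branch pcharK clX onX vF).
by rewrite [RHS]cone_eval_euler.
Qed.

(** The identity [T F = 0] is differentiated in [u], coefficient by coefficient; the cone variable
    comes out as a factor and is cancelled. *)
Lemma grad_branch_deriv F :
  vanishes X F -> dot (branch_grad F) (const_row (deriv_param beta)) = 0.
Proof.
move=> vF; apply: (mulIf nzX); rewrite mul0r.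
have := congr1 (map_poly (@fps_deriv K)) (lies_on_branch pcharK clX onX vF).
rewrite map_poly0 [LHS]cone_eval_derivation => [<-||c]; last 1 first.
- exact: fps_derivC.
- rewrite mulr_suml; apply: eq_bigr => i _; rewrite -mulrA; congr (_ * (_ * _)).
  by rewrite /const_row mxE.
- exact: fps_derivM.
Qed.

Definition polar_poly (i : 'I_4) : {mpoly K[4]} := \sum_j S j i *: 'X_j.

Lemma meval_polar_poly (v : 'rV[K]_4) i : (polar_poly i).@[v 0] = (v *m S) 0 i.
Proof.
rewrite raddf_sum mxE; apply: eq_bigr => j _.
by rewrite /= mevalZ mevalXU mulrC.
Qed.

Lemma branch_polar_poly i : T (polar_poly i) = ((beta *m SF) 0 i)%:P * 'X.
Proof.
rewrite raddf_sum mxE rmorph_sum mulr_suml; apply: eq_bigr => j _.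
by rewrite [LHS]branch_evalZX mxE.
Qed.

Definition branch_polar (i : 'I_4) : D := T (polar_poly i).

Lemma branch_polar_dot (p : 'rV[fps K]_4) :
  dot branch_polar (const_row p) = (bilinear_mx SF beta p)%:P * 'X.
Proof.
rewrite bilinear_mx_dot rmorph_sum mulr_suml; apply: eq_bigr => i _.
by rewrite /branch_polar branch_polar_poly rmorphM mulrAC.
Qed.

Let b := bilinear_mx SF beta (deriv_param beta).
Let Phi : 'rV[fps K]_4 := halphen_param (quadric q) beta.

Let PhiE i : const_row Phi i =
  b%:P * const_row beta i
  + (- bilinear_mx SF beta beta)%:P * const_row (deriv_param beta) i.
Proof.
rewrite /const_row /Phi halphen_param_quadric // -!polyCM -polyCD; congr (_%:P).
by rewrite [LHS]mxE [X in _ + X]mxE [X in _ - X]mxE [X in X - _]mxE mulNr.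
Qed.

Let dot_Phi f : dot f (const_row Phi) = b%:P * dot f (const_row beta)
  + (- bilinear_mx SF beta beta)%:P * dot f (const_row (deriv_param beta)).
Proof.
rewrite dotC (eq_dotl _ PhiE) dotDl !dotZl.
by congr (_ * _ + _ * _); apply: dotC.
Qed.

Lemma grad_halphen F : vanishes X F -> dot (branch_grad F) (const_row Phi) = 0.
Proof.
move=> vF; rewrite dot_Phi grad_branch // grad_branch_deriv //.
by rewrite !mulr0 addr0.
Qed.

Let cross_cancel (x y : fps K) :
  y%:P * (x%:P * 'X) + (- x)%:P * (y%:P * 'X) = 0 :> D.
Proof. by rewrite polyCN mulNr mulrCA subrr. Qed.

Lemma polar_halphen : dot branch_polar (const_row Phi) = 0.
Proof.
rewrite dot_Phi (branch_polar_dot beta) (branch_polar_dot (deriv_param beta)).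
exact: cross_cancel.
Qed.

(* At the generic point of the curve, the gradients of two well-chosen elements
   of its ideal cut out the tangent line, and the polar plane does not contain
   this line. *)
Lemma exists_jacobian_pair : exists F1 F2,
  [/\ vanishes X F1, vanishes X F2 &
      exists j, cross (branch_grad F1) (branch_grad F2) branch_polar j != 0].
Proof.
have jac := branch_jacobian pcharK curveX onX nz_l betaM alpha0 nz_alpha0 alpha3.
have [F1 [a1 [b1 [c1 [vF1 nz_a1 gF1]]]]] := jac 1.
have [F2 [a2 [b2 [c2 [vF2 nz_a2 gF2]]]]] := jac 2%:R.
exists F1, F2; split=> //.
pose f := branch_grad F1; pose g := branch_grad F2.
pose col j (i : 'I_4) : D := (fpsC (M i j))%:P.
pose row k (i : 'I_4) : D := (fpsC (invmx M k i))%:P.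
have col_row j k : dot (col j) (row k) = (k == j)%:R.
  rewrite /dot; under eq_bigr do rewrite -!rmorphM mulrC.
  have := congr1 (fun B : 'M[K]_4 => B k j) (mulVmx unitM).
  by rewrite -!rmorph_sum !mxE => ->; rewrite !rmorph_nat.
have col_beta j : dot (col j) (const_row beta) = (l * alpha 0 j)%:P.
  transitivity ((beta *m map_mx (@fpsC K) M) 0 j)%:P; last by rewrite betaM mxE.
  by rewrite mxE rmorph_sum; apply: eq_bigr => i _; rewrite rmorphM mulrC mxE.
have fE p : dot f p = a1 * dot (col 1) p + b1 * dot (col 0) p + c1 * dot (col ord_max) p.
  rewrite (eq_dotl (g := fun i => a1 * col 1 i + b1 * col 0 i + c1 * col ord_max i) _ gF1).
  by rewrite !dotDl !dotZl.
have gE p : dot g p = a2 * dot (col 2%:R) p + b2 * dot (col 0) p + c2 * dot (col ord_max) p.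
  rewrite (eq_dotl (g := fun i => a2 * col 2%:R i + b2 * col 0 i + c2 * col ord_max i) _ gF2).
  by rewrite !dotDl !dotZl.
(* The covector [x] kills [beta]. Paired with the dual vectors 0, 1, 2 and with [beta], the
   covectors [x], [f], [g], [h] give a triangular matrix with diagonal 1, [a1], [a2], [Q(beta) X].
   They are thus independent, and the cross product is not 0. *)
pose x (i : 'I_4) : D := col 0 i + (- (alpha 0 0)%:P) * col ord_max i.
have xE p : dot x p = dot (col 0) p - (alpha 0 0)%:P * dot (col ord_max) p.
  by rewrite dotDl dotZl mulNr.
pose W : 'M[D]_4 := \matrix_(i, j) nth x [:: row 0; row 1; row 2%:R; const_row beta] j i.
pose h := branch_polar.
have NW i j : (stack x f g h *m W) i j =
    dot (nth x [:: x; f; g; h] i) (nth x [:: row 0; row 1; row 2%:R; const_row beta] j).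
  by rewrite mxE; apply: eq_bigr => k _; rewrite !mxE.
have trigN : is_trig_mx (stack x f g h *m W).
  apply/is_trig_mxP => i j; rewrite NW.
  case: i j => -[|[|[|[|//]]]] ? [[|[|[|[|//]]]] ?] //= _;
    rewrite ?xE ?fE ?gE ?col_row ?col_beta ?mulr0 ?addr0 ?subr0 ?add0r //.
  - by rewrite alpha3 mulr1 rmorphM mulrC subrr.
  - by rewrite -(grad_branch vF1) [RHS]fE !col_beta.
  - by rewrite -(grad_branch vF2) [RHS]gE !col_beta.
have : \det (stack x f g h *m W) != 0.
  rewrite det_trig //; apply/prodf_neq0 => i _; rewrite NW.
  case: i => -[|[|[|[|//]]]] ? /=.
  - by rewrite xE !col_row mulr0 subr0 oner_neq0.
  - by rewrite fE !col_row mulr1 !mulr0 !addr0.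
  - by rewrite gE !col_row mulr1 !mulr0 !addr0.
  - by rewrite branch_polar_dot mulf_neq0 ?polyC_eq0.
rewrite det_mulmx det_stack mulf_eq0 negb_or => /andP[nz_x _].
apply: contrapT => noj; case/eqP: nz_x; apply: big1 => j _.
have [->|nzj] := eqVneq (cross f g h j) 0; first by rewrite mulr0.
by case: noj; exists j.
Qed.

Hypothesis nz_Phi : Phi != 0.

Lemma halphen_on_transform : lies_on (halphen_transform X (quadric q)) Phi.
Proof.
have [k nz_Phik] : exists k, const_row Phi k != 0.
  apply: contrapT => nok; case/eqP: nz_Phi; apply/rowP => k; rewrite [RHS]mxE.
  apply/eqP; apply: contrapT => nzk; apply: nok; exists k.
  by rewrite polyC_eq0; apply/negP.
have [F1 [F2 [vF1 vF2 [j nz_j]]]] := exists_jacobian_pair.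
pose grad F i : {mpoly K[4]} := F^`M(i).
have [Psi [TPsi evPsi]] : exists Psi : 'I_4 -> {mpoly K[4]},
    (forall i, T (Psi i) = cross (branch_grad F1) (branch_grad F2) branch_polar i)
    /\ (forall (m : 'rV[K]_4) i, (Psi i).@[m 0] = cross (fun i => (grad F1 i).@[m 0])
         (fun i => (grad F2 i).@[m 0]) ((m *m S) 0) i).
  exists (cross (grad F1) (grad F2) polar_poly); split=> [i|m i].
    exact: rmorph_cross.
  rewrite [LHS](rmorph_cross (meval (m 0))); congr (cofactor _ _ _).
  apply/matrixP => -[[|[|[|[|//]]]] lti] i'; rewrite !mxE //=.
  by rewrite meval_polar_poly mxE.
have Psi_Phi i i' : const_row Phi i * T (Psi i') = const_row Phi i' * T (Psi i).
  rewrite !TPsi.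
  exact: (cross_unique i i' (grad_halphen vF1) (grad_halphen vF2) polar_halphen).
(* By construction [Psi] is only tangent to [F1] and [F2]. Tangency to all the equations is checked
   on the branch, where [Psi] is proportional to [Phi], and carried over to the curve. *)
have Psi_tangent F : vanishes X F -> vanishes X (dot (grad F) Psi).
  move=> vF; apply: generic.
  have -> : T (dot (grad F) Psi) = dot (branch_grad F) (T \o Psi).
    exact: rmorph_dot.
  apply: (mulfI nz_Phik); rewrite mulr0.
  transitivity (T (Psi k) * dot (branch_grad F) (const_row Phi)).
    rewrite !mulr_sumr; apply: eq_bigr => i _.
    by rewrite /= mulrCA Psi_Phi [RHS]mulrCA; congr (_ * _); apply: mulrC.
  by rewrite grad_halphen ?mulr0.
move=> d G hG vG.
(* The first two factors discard the points on the quadric and those where [Psi] may vanish; at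
   every other point of the curve [Psi] gives the Halphen point. *)
pose H := quadric q * (Psi j * (G \mPo [tuple Psi i | i < 4])).
have vH : vanishes X H.
  move=> m Xm; rewrite /H !mevalM meval_quadric //.
  have [->|nzQ] := eqVneq (bilinear_mx S m m) 0; first by rewrite mul0r.
  have [->|nzp] := eqVneq (Psi j).@[m 0] 0; first by rewrite mul0r mulr0.
  pose p : 'rV[K]_4 := \row_i (Psi i).@[m 0].
  have nz_p : p != 0.
    by apply: contraNneq nzp => /rowP/(_ j); rewrite !mxE => ->.
  have pE i : p 0 i = cross (fun i => (grad F1 i).@[m 0])
      (fun i => (grad F2 i).@[m 0]) ((m *m S) 0) i by rewrite mxE evPsi.
  have tangent_dot F x : tangent_space X m x ->
      vanishes X F -> dot (fun i => (grad F i).@[m 0]) (x 0) = 0.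
    by move=> tx /tx.
  have polar_p : bilinear_mx S m p = 0.
    rewrite bilinear_mx_dot -[RHS](dot_crossr (fun i => (grad F1 i).@[m 0])
      (fun i => (grad F2 i).@[m 0]) ((m *m S) 0)).
    by apply: eq_bigr => i _; rewrite pE.
  have tangent_m : tangent_space X m m.
    move=> F vF; have := cone_eval_euler idfun (m 0) F.
    rewrite [cone_eval _ _ F](vanishes_line pcharK clX vF Xm) deriv0.
    move/(congr1 (fun P : {poly K} => P.[1])); rewrite horner0 horner_sum => E; rewrite [RHS]E.
    apply: eq_bigr => i _; rewrite hornerM hornerC horner_cone_eval.
    by congr (_ * _); apply: eq_mmap => i'; rewrite mulr1.
  have tangent_p : tangent_space X m p.
    move=> F vF; rewrite -[RHS](Psi_tangent F vF m Xm) [RHS](rmorph_dot (meval (m 0))).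
    by apply: eq_bigr => i _; rewrite mxE.
  have tangentB x y c : tangent_space X m x -> tangent_space X m y ->
      tangent_space X m (x + c *: y).
    move=> tx ty F vF.
    transitivity (\sum_i (F^`M(i)).@[m 0] * x 0 i + c * \sum_i (F^`M(i)).@[m 0] * y 0 i).
      rewrite mulr_sumr -big_split; apply: eq_bigr => i _ /=.
      by rewrite !mxE mulrDr [in LHS]mulrCA.
    by rewrite (tx F vF) (ty F vF) mulr0 addr0.
  have tangent0 : tangent_space X m 0.
    by move=> F _; apply: big1 => i _; rewrite mxE mulr0.
  have only_p x : tangent_space X m x -> bilinear_mx S m x = 0 ->
      exists c, x = c *: p.
    move=> tx px; exists (x 0 j / p 0 j); apply/rowP => i; rewrite mxE.
    have nzpj : p 0 j != 0 by rewrite mxE.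
    apply: (mulIf nzpj); rewrite mulrAC divfK // (pE i) (pE j).
    by apply: cross_unique; rewrite -?bilinear_mx_dot //; apply: tangent_dot.
  suff Halphen_p : halphen_point X (quadric q) m p.
    have : halphen_transform X (quadric q) p.
      by split=> // d' F hF; apply; exists m.
    move/vG => Gp; rewrite comp_mpoly_meval (_ : G.@[_] = 0) ?mulr0 // -Gp.
    by apply: eq_mmap => i; rewrite tnth_mktuple mxE.
  (* As [Q(m) != 0], a tangent vector minus its component along [m] lies in the polar plane, hence
     is a multiple of [p]: the tangent space is spanned by [m] and [p]. *)
  have nonsing : nonsingular_point X m.
    split=> //; exists p; split=> [x mp|x].
      have : x * bilinear_mx S m m = 0 by rewrite -bilinear_mxZr -mp.
      move/eqP; rewrite mulf_eq0 (negbTE nzQ) orbF => /eqP x0.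
      by move: nz_p; rewrite mp x0 scale0r eqxx.
    split=> [tx|[y [z ->]]]; last first.
      by rewrite -[y *: m]add0r; do 2!apply: (tangentB) => //; apply: tangent0.
    set y := bilinear_mx S m x / bilinear_mx S m m.
    have [||z xE] := only_p (x + (- y) *: m).
    - exact: tangentB.
    - by rewrite bilinear_mxDr bilinear_mxZr mulNr divfK // subrr.
    by exists y, z; rewrite -xE scaleNr addrC subrK.
  split=> // x; rewrite polar_form_quadric //; split=> [[tx px]|[c ->]].
    exact: only_p.
  split; last by rewrite bilinear_mxZr polar_p mulr0.
  by rewrite -[_ *: _]add0r; apply: tangentB => //; apply: tangent0.
have TH := lies_on_branch pcharK clX onX vH.
have nz_TQ : T (quadric q) != 0.
  apply: contraNneq nz_Qbeta => TQ0; rewrite -(mmap_quadric pcharK (@fpsC K)).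
  have := horner_cone_eval (@fpsC K) (beta 0) (quadric q) 1.
  rewrite [cone_eval _ _ _]TQ0 horner0 => /esym Q0; apply/eqP; rewrite -[RHS]Q0.
  by apply: eq_mmap => i; rewrite mulr1.
have TG : T (G \mPo [tuple Psi i | i < 4]) = 0.
  have nz_TPsij : T (Psi j) != 0 by rewrite TPsi.
  apply: (mulfI nz_TPsij); apply: (mulfI nz_TQ); rewrite !mulr0 -[RHS]TH.
  by rewrite /H rmorphM; congr (_ * _); rewrite rmorphM.
have nz_TPsik : T (Psi k) != 0.
  have : const_row Phi k * T (Psi j) != 0 by rewrite TPsi mulf_neq0.
  by rewrite Psi_Phi mulf_eq0 negb_or => /andP[].
(* By homogeneity of [G], proportionality gives [T (Psi k) ^+ d * G(Phi) = Phi_k ^+ d * G(T Psi)],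
   and the right-hand side is 0. *)
have : T (Psi k) ^+ d * (eval_fps G Phi)%:P = 0.
  rewrite /eval_fps [(mmap _ _ _)%:P](rmorph_mmap (polyC : {rmorphism fps K -> D}) (@fpsC K)).
  rewrite -(mmap_scale_homog _ _ _ hG).
  rewrite (eq_mmap _ (w := fun i => const_row Phi k * T (Psi i))) => [|i]; last first.
    by rewrite Psi_Phi mulrC.
  rewrite (mmap_scale_homog _ _ _ hG) -[RHS](mulr0 (const_row Phi k ^+ d)) -TG.
  congr (_ * _); rewrite [RHS]cone_eval_comp; apply: eq_mmap => i.
  by rewrite tnth_mktuple.
by move/eqP; rewrite mulf_eq0 expf_eq0 (negbTE nz_TPsik) andbF polyC_eq0 => /eqP.
Qed.

End HalphenTransform.

(** * The type of a branch from the orders of four linear forms *)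

Section LocalType.
Variable K : fieldType.
Implicit Types (f g h : fps K) (Phi : 'rV[fps K]_4) (w : 'cV[K]_4).

Definition column_comb Phi w : fps K := (Phi *m map_mx (@fpsC K) w) 0 0.

Lemma column_combE Phi w : column_comb Phi w = \sum_i Phi 0 i * fpsC (w i 0).
Proof. by rewrite /column_comb mxE; apply: eq_bigr => i _; rewrite mxE. Qed.

Lemma column_combZ Phi w (x : K) :
  column_comb Phi (x *: w) = fpsC x * column_comb Phi w.
Proof.
rewrite !column_combE mulr_sumr; apply: eq_bigr => i _.
by rewrite mxE rmorphM mulrCA.
Qed.

Lemma has_ord_scale n (x : K) f : x != 0 -> has_ord n f -> has_ord n (fpsC x * f).
Proof.
move=> x0 [fn fn0]; split; first exact: ord_geMl.
by rewrite coef_fpsCM mulf_neq0.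
Qed.

Lemma has_ord_unscale n (x : K) f : x != 0 -> has_ord n (fpsC x * f) -> has_ord n f.
Proof.
move=> x0 /(has_ord_scale (invr_neq0 x0)).
by rewrite mulrA -rmorphM mulVf // rmorph1 mul1r.
Qed.

Let factor_out (A : comNzRingType) (x u1 u2 g c v : A) :
  c * v = 1 -> x * (u1 * u2 * g) = u1 * c * (u2 * (x * (g * v))).
Proof. by move=> cv; rewrite -[LHS]mulr1 -cv; ring. Qed.

(** In a vanishing combination, nothing can cancel the leading coefficient of the term of least
    order. *)
Lemma ord_free (F : 'I_4 -> fps K) (n : 'I_4 -> nat) (v : 'I_4 -> K) :
  injective n -> (forall i, has_ord (n i) (F i)) ->
  \sum_i F i * fpsC (v i) = 0 -> forall i, v i = 0.
Proof.
move=> inj_n ordF Fv i; have [k] := ubnP (n i).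
elim: k i => // k IHk i; rewrite ltnS => le_k.
have := congr1 (fun f : fps K => f (n i)) Fv.
rewrite coef_fps_sum coef_fps0; under eq_bigr do rewrite mulrC coef_fpsCM.
rewrite (bigD1 i) //= big1 ?addr0 => [|j ne_ji].
  move/eqP; rewrite mulf_eq0.
  by case: (ordF i) => _ /negbTE->; rewrite orbF => /eqP.
have [lt_ji|lt_ij|/inj_n eq_ji] := ltngtP (n j) (n i).
- by rewrite IHk ?mul0r // (leq_trans lt_ji).
- by have [Fj _] := ordF j; rewrite (Fj _ lt_ij) mulr0.
- by case/eqP: ne_ji.
Qed.

Lemma has_ord_scale_col n (x : K) Phi w :
  x != 0 -> has_ord n (column_comb Phi w) -> has_ord n (column_comb Phi (x *: w)).
Proof. by move=> x0 ordw; rewrite column_combZ; apply: has_ord_scale. Qed.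

(** Dividing by the form of least order turns it into the coordinate 1 and lowers the other orders
    by [n i0]; rescaling the columns makes the leading coefficients 1. The matrix of the four forms
    is invertible because the orders are distinct. *)
Lemma type_of_orders Phi (w : 'I_4 -> 'cV[K]_4) (n : 'I_4 -> nat)
    (i0 i1 i2 i3 : 'I_4) :
  (n i0 < n i1)%N -> (n i1 < n i2)%N -> (n i2 < n i3)%N ->
  (forall i, has_ord (n i) (column_comb Phi (w i))) ->
  exists a b c, normal_form Phi (n i1 - n i0) (n i2 - n i0) (n i3 - n i0) a b c.
Proof.
move=> lt01 lt12 lt23 ordw.
have [c0 ord0] : exists g, column_comb Phi (w i0) = 'u ^+ (n i0) * g /\ g 0%N != 0.
  by case: (ordw i0) => /ord_geP[g [-> g0]] nz; exists g; rewrite g0.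
have [v [c0v _]] := fps_inverse ord0.2.
have scaled i : (n i0 <= n i)%N -> exists (x : K) (a : fps K), [/\ x != 0, a 0%N = 1 &
    column_comb Phi (x *: w i) =
    column_comb Phi (w i0) * ('u ^+ (n i - n i0) * a)].
  move=> le_i; have [/ord_geP[g [gE g0]] nz] := ordw i.
  have nzv : v 0%N != 0.
    have := congr1 (fun f : fps K => f 0%N) c0v.
    rewrite (@coef_ord_geM _ 0 0) // coef_fps1 => E.
    by apply: contraTneq isT => v0; move: E; rewrite v0 mulr0 => /esym/eqP; rewrite oner_eq0.
  have nzx : g 0%N * v 0%N != 0 by rewrite g0 mulf_neq0.
  exists (g 0%N * v 0%N)^-1, (fpsC (g 0%N * v 0%N)^-1 * (g * v)); split.
  - by rewrite invr_neq0.
  - by rewrite coef_fpsCM (@coef_ord_geM _ 0 0) // mulVf.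
  by rewrite column_combZ gE ord0.1 -{1}(subnKC le_i) exprD; apply: factor_out.
have [x1 [a1 [nz1 a10 E1]]] := scaled i1 (ltnW lt01).
have [x2 [a2 [nz2 a20 E2]]] := scaled i2 (ltnW (ltn_trans lt01 lt12)).
have [x3 [a3 [nz3 a30 E3]]] := scaled i3 (ltnW (ltn_trans lt01 (ltn_trans lt12 lt23))).
exists a1, a2, a3; split; rewrite ?a10 ?a20 ?a30 //; [lia|lia|].
pose W (j : 'I_4) := nth (w i0) [:: x1 *: w i1; x2 *: w i2; x3 *: w i3] j.
pose M : 'M[K]_4 := \matrix_(i, j) W j i 0.
have PhiM j : (Phi *m map_mx (@fpsC K) M) 0 j = column_comb Phi (W j).
  by rewrite column_combE mxE; apply: eq_bigr => i _; rewrite !mxE.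
exists M, (column_comb Phi (w i0)); split.
- rewrite -unitmx_tr unitmxE unitfE; apply/det0P => -[v0 nz_v0 vM].
  pose m j := nth (n i0) [:: n i1; n i2; n i3] j.
  have inj_m : injective (fun j : 'I_4 => m j).
    move=> [[|[|[|[|//]]]] ?] [[|[|[|[|//]]]] ?] /= E; apply: val_inj => //=;
      by move: lt01 lt12 lt23 E; rewrite /m /=; lia.
  case/eqP: nz_v0; apply/rowP => i; rewrite [RHS]mxE; move: i.
  apply: (ord_free inj_m (F := fun j => column_comb Phi (W j))).
    move=> [[|[|[|[|//]]]] ?]; rewrite /W /m /=; last exact: ordw.
    - exact: has_ord_scale_col.
    - exact: has_ord_scale_col.
    - exact: has_ord_scale_col.
  transitivity ((Phi *m map_mx (@fpsC K) (v0 *m M^T)^T) 0 0).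
    rewrite trmx_mul trmxK map_mxM mulmxA mxE.
    by apply: eq_bigr => j _; rewrite PhiM !mxE.
  by rewrite vM trmx0 map_mx0 mulmx0 mxE.
- exact: has_ord_neq0 (ordw i0).
apply/rowP => j; rewrite PhiM !mxE.
by case: j => -[|[|[|[|//]]]] ? /=; rewrite ?E1 ?E2 ?E3 ?mulr1.
Qed.

End LocalType.

(** * The Halphen map in the coordinates of the branch *)

Section LocalHalphen.
Variable K : fieldType.
Hypothesis pcharK : [pchar K] =i pred0.
Implicit Types (f g h : fps K) (alpha beta : 'rV[fps K]_4) (w : 'cV[K]_4).
Implicit Types S : 'M[K]_4.
Local Notation lift S := (map_mx (@fpsC K) S).

Let natK n : (n%:R == 0 :> K) = (n == 0%N).
Proof. exact: (pcharf0P K).1. Qed.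

Definition gram_halphen S alpha : 'rV[fps K]_4 :=
  bilinear_mx (lift S) alpha (deriv_param alpha) *: alpha
  - bilinear_mx (lift S) alpha alpha *: deriv_param alpha.

Lemma column_comb_deriv alpha w :
  column_comb (deriv_param alpha) w = fps_deriv (column_comb alpha w).
Proof.
rewrite !column_combE raddf_sum; apply: eq_bigr => i _.
by rewrite /= fps_derivM fps_derivC mulr0 addr0 mxE.
Qed.

Lemma column_comb_gram_halphen S alpha w :
  column_comb (gram_halphen S alpha) w =
  bilinear_mx (lift S) alpha (deriv_param alpha) * column_comb alpha w
  - bilinear_mx (lift S) alpha alpha * fps_deriv (column_comb alpha w).
Proof.
rewrite -column_comb_deriv /column_comb /gram_halphen mulmxBl -!scalemxAl.
by rewrite [LHS]mxE [X in _ + X]mxE [X in X - _]mxE [X in _ - X]mxE.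
Qed.

Lemma deriv_paramZ l alpha :
  deriv_param (l *: alpha) = fps_deriv l *: alpha + l *: deriv_param alpha.
Proof. by apply/rowP => i; rewrite !mxE fps_derivM. Qed.

Lemma deriv_param_mul alpha (N : 'M[K]_4) :
  deriv_param (alpha *m lift N) = deriv_param alpha *m lift N.
Proof.
apply/rowP => j; rewrite !mxE raddf_sum; apply: eq_bigr => i _.
by rewrite !mxE /= fps_derivM fps_derivC mulr0 addr0.
Qed.

Lemma bilinear_mx_mul (A : comNzRingType) (S N : 'M[A]_4) (v w : 'rV[A]_4) :
  bilinear_mx S (v *m N) (w *m N) = bilinear_mx (N *m S *m N^T) v w.
Proof. by rewrite /bilinear_mx trmx_mul !mulmxA. Qed.

Lemma bilinear_mx_derivation (A : comNzRingType) (d : {additive A -> A})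
    (S : 'M[A]_4) (v w : 'rV[A]_4) :
  (forall x y, d (x * y) = d x * y + x * d y) -> (forall i j, d (S i j) = 0) ->
  d (bilinear_mx S v w) = bilinear_mx S (map_mx d v) w + bilinear_mx S v (map_mx d w).
Proof.
move=> dM dS; rewrite /bilinear_mx !mxE raddf_sum -big_split.
apply: eq_bigr => i _ /=; rewrite dM; congr (_ * _ + _ * _); rewrite !mxE //.
rewrite raddf_sum; apply: eq_bigr => j _ /=.
by rewrite dM dS mulr0 addr0 mxE.
Qed.

(** With [h = L^2 - c Q], both sides are [L^3] times the derivative of [h / L^2 = 1 - c Q / L^2]. *)
Lemma derivation_square (A : comNzRingType) (d : {additive A -> A}) (c L Q b : A) :
  (forall x y, d (x * y) = d x * y + x * d y) -> d c = 0 -> d Q = b *+ 2 ->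
  d (L * L - c * Q) * L - (L * L - c * Q) * d L *+ 2
  = - ((2%:R * c) * (b * L - Q * d L)).
Proof. by move=> dM dc dQ; rewrite raddfB /= !dM dc dQ; ring. Qed.

(** The contributions of [l'] to the two summands cancel, which leaves the factor [l ^+ 3]: the
    Halphen map does not depend on the choice of homogeneous coordinates, and a linear change of
    variables acts on the Gram matrix by congruence. *)
Lemma bilinear_comb_transport (A : comNzRingType) (S N M : 'M[A]_4) (l l' : A)
    (v v' : 'rV[A]_4) :
  N *m M = 1%:M ->
  let beta := l *: (v *m N) in let beta' := l' *: (v *m N) + l *: (v' *m N) in
  (bilinear_mx S beta beta' *: beta - bilinear_mx S beta beta *: beta') *m M =
  l ^+ 3 *: (bilinear_mx (N *m S *m N^T) v v' *: v
             - bilinear_mx (N *m S *m N^T) v v *: v').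
Proof.
move=> NM beta beta'; rewrite /beta' /beta bilinear_mxDr !bilinear_mxZr !bilinear_mxZl.
rewrite !bilinear_mx_mul; move: (bilinear_mx _ v v) (bilinear_mx _ v v') => Q b.
rewrite -!scaleNr mulmxDl -!scalemxAl mulmxDl -!scalemxAl -!mulmxA NM !mulmx1.
rewrite !scalerDr !scalerA addrA -scalerDl; congr (_ *: _ + _ *: _); ring.
Qed.

Lemma halphen_transport q M l alpha beta :
  M \in unitmx -> beta *m lift M = l *: alpha ->
  halphen_param (quadric q) beta *m lift M =
  l ^+ 3 *: gram_halphen (invmx M *m gram q *m (invmx M)^T) alpha.
Proof.
move=> unitM betaM; set N := invmx M.
have betaE : beta = l *: (alpha *m lift N).
  by rewrite scalemxAl -betaM -mulmxA -map_mxM mulmxV // map_mx1 mulmx1.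
have NM : lift N *m lift M = 1%:M by rewrite -map_mxM mulVmx // map_mx1.
have liftS : lift (N *m gram q *m N^T) = lift N *m lift (gram q) *m (lift N)^T.
  by rewrite !map_mxM map_trmx.
rewrite (halphen_param_quadric pcharK) betaE deriv_paramZ deriv_param_mul.
by rewrite /gram_halphen liftS -(bilinear_comb_transport _ l (fps_deriv l) _ _ NM).
Qed.

Lemma normal_form_transport q M l alpha beta e r s a b c :
  M \in unitmx -> l != 0 -> beta *m lift M = l *: alpha ->
  normal_form (gram_halphen (invmx M *m gram q *m (invmx M)^T) alpha) e r s a b c ->
  normal_form (halphen_param (quadric q) beta) e r s a b c.
Proof.
move=> unitM nz_l betaM [lt_e lt_r abc [M' [l' [unitM' nz_l' E]]]].
split=> //; exists (M *m M'), (l ^+ 3 * l'); split.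
- by rewrite unitmx_mul unitM.
- by rewrite mulf_neq0 // expf_neq0.
by rewrite map_mxM mulmxA (halphen_transport q unitM betaM) -scalemxAl E scalerA.
Qed.

Lemma normal_form_neq0 beta e r s (a b c : fps K) :
  normal_form beta e r s a b c -> beta != 0.
Proof.
case=> _ _ _ [M [l [_ nz_l E]]]; apply: contraNneq nz_l => b0.
move/rowP: E => /(_ ord_max); rewrite b0 mul0mx !mxE /= mulr1 => <-.
exact: eqxx.
Qed.

Section Orders.
Variables (S : 'M[K]_4) (alpha : 'rV[fps K]_4).
Hypothesis symS : S^T = S.
Local Notation Q := (bilinear_mx (lift S) alpha alpha).
Local Notation b := (bilinear_mx (lift S) alpha (deriv_param alpha)).

Lemma deriv_quadratic : fps_deriv Q = b *+ 2.
Proof.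
have symF : (lift S)^T = lift S by rewrite map_trmx symS.
rewrite (@bilinear_mx_derivation _ (@fps_deriv K)) => [|f g|i j]; first last.
- by rewrite mxE; apply: fps_derivC.
- exact: fps_derivM.
by rewrite (bilinear_mxC (map_mx _ _) _ symF) mulr2n.
Qed.

(** In [b L - Q L'] the second term dominates: [Q] is invertible, and in characteristic 0
    differentiation lowers a positive order by exactly one. *)
Lemma has_ord_halphen n w : Q 0%N != 0 -> has_ord n.+1 (column_comb alpha w) ->
  has_ord n (column_comb (gram_halphen S alpha) w).
Proof.
move=> nzQ [Ln nzL]; rewrite column_comb_gram_halphen.
move: (column_comb _ _) Ln nzL => L Ln nzL.
have L'n := ord_ge_deriv Ln.
split; first by apply: ord_geB; apply: ord_geMl => //; apply: ord_geW Ln.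
rewrite coef_fpsB (ord_geMl b Ln) // sub0r oppr_eq0.
rewrite (@coef_ord_geM _ 0 n) // mulf_neq0 // coef_fps_deriv.
by rewrite -mulr_natr mulf_neq0 // natK.
Qed.

(* The column is the linear form that best approximates a square root of [c Q]:
   [b L - Q L'] is [- Q^(3/2)] times the derivative of [L / sqrt Q]. *)
Lemma has_ord_halphen_sqrt n w (c : K) (L := column_comb alpha w) :
  c != 0 -> L 0%N != 0 -> has_ord n.+1 (L * L - fpsC c * Q) ->
  has_ord n (column_comb (gram_halphen S alpha) w).
Proof.
move=> nz_c nz_L; pose h := L * L - fpsC c * Q; rewrite -/h => hn.
have key : fps_deriv h * L - h * fps_deriv L *+ 2
    = - (fpsC (2%:R * c) * column_comb (gram_halphen S alpha) w).
  rewrite column_comb_gram_halphen -/L rmorphM rmorph_nat.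
  apply: (@derivation_square _ (@fps_deriv K)); first exact: fps_derivM.
    exact: fps_derivC.
  exact: deriv_quadratic.
have nz2c : 2%:R * c != 0 by rewrite mulf_neq0 ?natK.
apply: (has_ord_unscale nz2c); rewrite -[fpsC _ * _]opprK -key.
move: {key} h hn => h [hn nz_h].
have h'n := ord_ge_deriv hn.
split.
  apply: ord_geN; apply: ord_geB; first exact: ord_geMr.
  by apply: ord_geMn; apply: ord_geMr; apply: ord_geW hn.
rewrite coef_fpsN oppr_eq0 coef_fpsB (ord_geMn 2 (ord_geMr (fps_deriv L) hn)) // subr0.
rewrite -[n]addn0 (@coef_ord_geM _ n 0) // mulf_neq0 // coef_fps_deriv.
by rewrite -mulr_natr mulf_neq0 // natK.
Qed.

End Orders.
End LocalHalphen.

(** * The defect [L^2 - q Q] of the approximate square root *)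

Lemma ord4P (T : Type) (op : T -> T -> T) (idx : T) (F : 'I_4 -> T) :
  \big[op/idx]_(i < 4) F i =
  op (F 0) (op (F 1) (op (F 2%:R) (op (F ord_max) idx))).
Proof.
rewrite !big_ord_recl big_ord0.
have -> : lift ord0 ord0 = 1 :> 'I_4 by apply: val_inj.
have -> : lift ord0 (lift ord0 ord0) = 2%:R :> 'I_4 by apply: val_inj.
by have -> : lift ord0 (lift ord0 (lift ord0 ord0)) = ord_max :> 'I_4 by apply: val_inj.
Qed.

(** With [o] the base point and [b] the polar form, these are the entries of the Gram matrix of
    [b(o, .)^2 - Q(o) Q], the equation of the tangent cone drawn from [o] to the quadric. *)
Definition tangent_minor (A : comNzRingType) (S : 'I_4 -> 'I_4 -> A) i j : A :=
  S i ord_max * S j ord_max - S ord_max ord_max * S i j.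

Section SquareDefect.
Variable A : comNzRingType.

(* [L ^ 2 - q Q], where [Q] has Gram matrix [S] and constant term [q], and [L] is
   the polar form of the base point, corrected by [e1] and [e2] along the last two
   affine coordinates; [y], [z] stand for these coordinates, and [xx], [xy],
   ..., for the products of two coordinates. *)
Definition square_defect (S : 'I_4 -> 'I_4 -> A) (e1 e2 : A) (y z xx xy xz yy yz zz : A) : A :=
  let m := tangent_minor S in
  2%:R * S ord_max ord_max * e1 * y + 2%:R * S ord_max ord_max * e2 * z
  + m 0 0 * xx + 2%:R * (m 0 1 + S 0 ord_max * e1) * xy
  + 2%:R * (m 0 2%:R + S 0 ord_max * e2) * xz
  + (m 1 1 + 2%:R * S 1 ord_max * e1 + e1 ^+ 2) * yy
  + 2%:R * (m 1 2%:R + S 1 ord_max * e2 + S 2%:R ord_max * e1 + e1 * e2) * yz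
  + (m 2%:R 2%:R + 2%:R * S 2%:R ord_max * e2 + e2 ^+ 2) * zz.

Lemma square_defectE (S : 'M[A]_4) (v : 'rV[A]_4) (e1 e2 : A) :
  S^T = S -> v 0 ord_max = 1 ->
  let L := S ord_max ord_max + S 0 ord_max * v 0 0 + (S 1 ord_max + e1) * v 0 1
           + (S 2%:R ord_max + e2) * v 0 2%:R in
  L * L - S ord_max ord_max * bilinear_mx S v v =
  square_defect S e1 e2 (v 0 1) (v 0 2%:R) (v 0 0 * v 0 0) (v 0 0 * v 0 1)
    (v 0 0 * v 0 2%:R) (v 0 1 * v 0 1) (v 0 1 * v 0 2%:R) (v 0 2%:R * v 0 2%:R).
Proof.
move=> symS v3 L; have sym i j : S i j = S j i by rewrite -{1}symS mxE.
rewrite bilinear_mx_dot /dot ord4P !mxE !ord4P v3 /L /square_defect /tangent_minor.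
rewrite (sym 1 0) (sym 2%:R 0) (sym 2%:R 1) (sym ord_max 0) (sym ord_max 1) (sym ord_max 2%:R).
ring.
Qed.

End SquareDefect.

Lemma square_defect_morph (A B : comNzRingType) (phi : {rmorphism A -> B})
    (S : 'I_4 -> 'I_4 -> A) (e1 e2 : A) (y z xx xy xz yy yz zz : B) :
  let m := tangent_minor S in
  square_defect (fun i j => phi (S i j)) (phi e1) (phi e2) y z xx xy xz yy yz zz =
  phi (2%:R * S ord_max ord_max * e1) * y + phi (2%:R * S ord_max ord_max * e2) * z
  + phi (m 0 0) * xx + phi (2%:R * (m 0 1 + S 0 ord_max * e1)) * xy
  + phi (2%:R * (m 0 2%:R + S 0 ord_max * e2)) * xz
  + phi (m 1 1 + 2%:R * S 1 ord_max * e1 + e1 ^+ 2) * yy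
  + phi (2%:R * (m 1 2%:R + S 1 ord_max * e2 + S 2%:R ord_max * e1 + e1 * e2)) * yz
  + phi (m 2%:R 2%:R + 2%:R * S 2%:R ord_max * e2 + e2 ^+ 2) * zz.
Proof.
move=> m; rewrite /square_defect /m /tangent_minor.
by rewrite !(rmorphD, rmorphM, rmorphB, rmorphXn, rmorph_nat) /= ?rmorphN ?rmorphM.
Qed.

Lemma coef_square_defect (K : fieldType) (S : 'I_4 -> 'I_4 -> K) (e1 e2 : K)
    (y z xx xy xz yy yz zz : fps K) k :
  square_defect (fun i j => fpsC (S i j)) (fpsC e1) (fpsC e2)
    y z xx xy xz yy yz zz k =
  square_defect S e1 e2 (y k) (z k) (xx k) (xy k) (xz k) (yy k) (yz k) (zz k).
Proof.
by rewrite (square_defect_morph (@fpsC K)) !coef_fpsD !coef_fpsCM.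
Qed.

Lemma square_defect_ext (A : comNzRingType) (S S' : 'I_4 -> 'I_4 -> A) (e1 e2 : A) :
  (forall i j, S i j = S' i j) ->
  forall y z xx xy xz yy yz zz, square_defect S e1 e2 y z xx xy xz yy yz zz
                              = square_defect S' e1 e2 y z xx xy xz yy yz zz.
Proof. by move=> SS' *; rewrite /square_defect /tangent_minor !SS'. Qed.

(** * Orders of the four forms on the image branch *)

Section BranchOrders.
Variable K : fieldType.
Hypothesis pcharK : [pchar K] =i pred0.
Variables (e r s : nat) (a b c : fps K).
Hypotheses (e_gt0 : (0 < e)%N) (lt_er : (e < r)%N) (lt_rs : (r < s)%N).
Hypotheses (a0 : a 0%N = 1) (b0 : b 0%N = 1) (c0 : c 0%N = 1).
Variable S : 'M[K]_4.
Hypothesis symS : S^T = S.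
Local Notation q0 := (S ord_max ord_max).
Hypothesis nz_q0 : q0 != 0.

Let alpha := standard_param e r s a b c.
Local Notation x := ('u ^+ e * a).
Local Notation y := ('u ^+ r * b).
Local Notation z := ('u ^+ s * c).

Let reorder (A : comNzRingType) (x y z p0 p1 p2 q e1 e2 : A) :
  x * p0 + (y * (p1 + e1) + (z * (p2 + e2) + (1 * q + 0)))
  = q + p0 * x + (p1 + e1) * y + (p2 + e2) * z.
Proof. by ring. Qed.

Let alpha0 : alpha 0 0 = x. Proof. by rewrite mxE. Qed.
Let alpha1 : alpha 0 1 = y. Proof. by rewrite mxE. Qed.
Let alpha2 : alpha 0 2%:R = z. Proof. by rewrite mxE. Qed.
Let alpha3 : alpha 0 ord_max = 1. Proof. by rewrite mxE. Qed.

Lemma coef_powM_lead n (f : fps K) : f 0%N = 1 -> ('u ^+ n * f) n = 1.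
Proof. by move=> f0; rewrite coef_fpsXnM ltnn subnn. Qed.

Let ord_x : ord_ge e x. Proof. exact: ord_ge_Xn. Qed.
Let ord_y : ord_ge r y. Proof. exact: ord_ge_Xn. Qed.
Let ord_z : ord_ge s z. Proof. exact: ord_ge_Xn. Qed.

Definition tangent_column (e1 e2 : K) : 'cV[K]_4 :=
  \col_i nth 0 [:: S 0 ord_max; S 1 ord_max + e1; S 2%:R ord_max + e2; q0] i.

Definition sqrt_defect (e1 e2 : K) : fps K :=
  column_comb alpha (tangent_column e1 e2) * column_comb alpha (tangent_column e1 e2)
  - fpsC q0 * bilinear_mx (map_mx (@fpsC K) S) alpha alpha.

Lemma sqrt_defectE e1 e2 k : sqrt_defect e1 e2 k =
  square_defect S e1 e2 (y k) (z k) ((x * x) k) ((x * y) k) ((x * z) k)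
    ((y * y) k) ((y * z) k) ((z * z) k).
Proof.
rewrite -coef_square_defect; congr (fcoef _ k).
have symF : (map_mx (@fpsC K) S)^T = map_mx (@fpsC K) S by rewrite map_trmx symS.
have SF i j : map_mx (@fpsC K) S i j = fpsC (S i j) by rewrite mxE.
rewrite -(square_defect_ext _ _ SF) -alpha0 -alpha1 -alpha2 -(square_defectE _ _ symF alpha3).
rewrite /sqrt_defect !SF.
suff -> : column_comb alpha (tangent_column e1 e2) =
    fpsC q0 + fpsC (S 0 ord_max) * alpha 0 0 + (fpsC (S 1 ord_max) + fpsC e1) * alpha 0 1
    + (fpsC (S 2%:R ord_max) + fpsC e2) * alpha 0 2%:R by [].
rewrite column_combE ord4P alpha3 /tangent_column.
have colE i : (tangent_column e1 e2) i 0 =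
    nth 0 [:: S 0 ord_max; S 1 ord_max + e1; S 2%:R ord_max + e2; q0] i by rewrite mxE.
rewrite !colE /= !rmorphD.
exact: reorder.
Qed.

Lemma column_comb0 e1 e2 : column_comb alpha (tangent_column e1 e2) 0%N = q0.
Proof.
rewrite column_combE coef_fps_sum; under eq_bigr do rewrite mulrC coef_fpsCM.
rewrite ord4P alpha0 alpha1 alpha2 alpha3 coef_fps1.
rewrite (ord_x e_gt0) (ord_y (ltn_trans e_gt0 lt_er)).
rewrite (ord_z (ltn_trans e_gt0 (ltn_trans lt_er lt_rs))).
by rewrite !mulr0 !add0r addr0 mulr1 mxE.
Qed.

(** Read off the defect, which vanishes at [u = 0]: there [L] is [q0], so that
    [q0 * q0 = q0 * Q(0)], and [q0] cancels. *)
Lemma quadratic0 : bilinear_mx (map_mx (@fpsC K) S) alpha alpha 0%N = q0.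
Proof.
have := sqrt_defectE 0 0 0; rewrite /square_defect.
have zero2 (f g : fps K) : ord_ge 1 f -> (f * g) 0%N = 0 by move=> f1; rewrite (ord_geMr g f1).
have x1 : ord_ge 1 x := ord_geW e_gt0 ord_x.
have y1 : ord_ge 1 y := ord_geW (ltn_trans e_gt0 lt_er) ord_y.
have z1 : ord_ge 1 z := ord_geW (ltn_trans e_gt0 (ltn_trans lt_er lt_rs)) ord_z.
rewrite (y1 0%N isT) (z1 0%N isT) (zero2 x x x1) (zero2 x y x1) (zero2 x z x1).
rewrite (zero2 y y y1) (zero2 y z y1) (zero2 z z z1) !mulr0 !addr0.
rewrite /sqrt_defect; move: (column_comb0 0 0).
move: (column_comb _ _) (bilinear_mx _ _ _) => L B L0.
rewrite coef_fpsB coef_fpsCM coef_fpsM big_ord1 L0 -mulrBr => /eqP.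
by rewrite mulf_eq0 (negbTE nz_q0) /= subr_eq0 => /eqP.
Qed.

Lemma column_comb_delta i : column_comb alpha (delta_mx i 0) = alpha 0 i.
Proof.
rewrite column_combE (bigD1 i) //= big1 => [|j ne_ji].
  by rewrite [delta_mx _ _ _ _]mxE !eqxx rmorph1 mulr1 addr0.
by rewrite [delta_mx _ _ _ _]mxE (negbTE ne_ji) rmorph0 mulr0.
Qed.

(** One more than the orders on the image. Index 3 is the default of [nth]: there [v] is the order
    of the defect, not of the form itself, whose value at 0 is [q0]. *)
Definition orders (v : nat) (i : 'I_4) : nat := nth v [:: e; r; s] i.

Definition order_columns e1 e2 (i : 'I_4) : 'cV[K]_4 :=
  nth (tangent_column e1 e2) [:: delta_mx 0 0; delta_mx 1 0; delta_mx 2%:R 0] i.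

Lemma has_ord_columns e1 e2 v : (0 < v)%N -> has_ord v (sqrt_defect e1 e2) ->
  forall i, has_ord (orders v i).-1
              (column_comb (gram_halphen S alpha) (order_columns e1 e2 i)).
Proof.
move=> v_gt0 ordv.
have coord n f i : (0 < n)%N -> alpha 0 i = 'u ^+ n * f -> f 0%N = 1 ->
    has_ord n.-1 (column_comb (gram_halphen S alpha) (delta_mx i 0)).
  move=> n0 E f0; apply: has_ord_halphen => //; first by rewrite quadratic0.
  rewrite prednK // column_comb_delta E; split; first exact: ord_ge_Xn.
  by rewrite coef_powM_lead // oner_neq0.
have r0 := ltn_trans e_gt0 lt_er; have s0 := ltn_trans r0 lt_rs.
case=> -[|[|[|[|//]]]] lti; rewrite /orders /order_columns /=.
- exact: coord alpha0 a0.
- exact: coord alpha1 b0.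
- exact: coord alpha2 c0.
apply: (has_ord_halphen_sqrt pcharK symS nz_q0); first by rewrite column_comb0.
by rewrite prednK.
Qed.

(** The indices sort the four orders. The common shift by one disappears in the differences, the
    least order being positive. *)
Lemma halphen_type e1 e2 v (i0 i1 i2 i3 : 'I_4) x1 x2 x3 :
  (0 < v)%N -> has_ord v (sqrt_defect e1 e2) ->
  (0 < orders v i0)%N -> (orders v i0 < orders v i1)%N ->
  (orders v i1 < orders v i2)%N -> (orders v i2 < orders v i3)%N ->
  orders v i1 = (x1 + orders v i0)%N -> orders v i2 = (x2 + orders v i0)%N ->
  orders v i3 = (x3 + orders v i0)%N ->
  exists a b c, normal_form (gram_halphen S alpha) x1 x2 x3 a b c.
Proof.
move=> v0 ordv n0 lt01 lt12 lt23 E1 E2 E3.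
have [|||f1 [f2 [f3 H]]] := type_of_orders _ _ _ (has_ord_columns v0 ordv)
  (i0 := i0) (i1 := i1) (i2 := i2) (i3 := i3).
- lia.
- lia.
- lia.
exists f1, f2, f3; move: H.
have -> : ((orders v i1).-1 - (orders v i0).-1)%N = x1 by lia.
have -> : ((orders v i2).-1 - (orders v i0).-1)%N = x2 by lia.
by have -> : ((orders v i3).-1 - (orders v i0).-1)%N = x3 by lia.
Qed.

End BranchOrders.

(* Up to the factor [q] and a power of [2 q], each condition is the leading
   coefficient of [square_defect] for the corrections [e1], [e2] that cancel its
   terms of low order; [x], [y], [g] are coefficients of combinations of the
   components of the branch, and [t] is 1 or 0 according to whether the maximal
   order is attained. *)
Section Conditions.
Variable A : comNzRingType.
Implicit Type S : 'I_4 -> 'I_4 -> A.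

Definition generic_cond S : A := S ord_max ord_max * tangent_minor S 0 0.

Definition parabolic_cond S (x t : A) : A :=
  let q := S ord_max ord_max in let m := tangent_minor S in
  q * (q * m 0 0 * x + (2%:R * q * m 0 1 - S 0 ord_max * m 0 0) * t).

Definition cubic_cond S (g x y t : A) : A :=
  let q := S ord_max ord_max in let m := tangent_minor S in
  let p := 2%:R * q * m 0 1 - S 0 ord_max * m 0 0 in
  q * (4%:R * q ^+ 2 * m 0 0 * x + 4%:R * q * p * y
       + (8%:R * q ^+ 2 * m 0 2%:R + 4%:R * q ^+ 2 * m 1 1
          - 4%:R * S 0 ord_max * (q * m 0 0 * g + p)
          - 4%:R * S 1 ord_max * q * m 0 0 + m 0 0 ^+ 2) * t).

Definition skew_cond S (x t : A) : A :=
  let m := tangent_minor S in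
  S ord_max ord_max * (m 0 0 * x + 2%:R * m 0 1 * t).

End Conditions.

(** * The order of the defect, case by case *)

Section Cases.
Variable K : fieldType.
Hypothesis pcharK : [pchar K] =i pred0.
Variables (e r s : nat) (a b c : fps K).
Hypotheses (e_gt0 : (0 < e)%N) (lt_er : (e < r)%N) (lt_rs : (r < s)%N).
Hypotheses (a0 : a 0%N = 1) (b0 : b 0%N = 1) (c0 : c 0%N = 1).
Variable S : 'M[K]_4.
Hypothesis symS : S^T = S.
Local Notation q0 := (S ord_max ord_max).
Local Notation x := ('u ^+ e * a).
Local Notation y := ('u ^+ r * b).
Local Notation z := ('u ^+ s * c).
Local Notation m := (tangent_minor S).
Local Notation defect := (sqrt_defect e r s a b c S).

Let two_neq0 : 2%:R != 0 :> K.
Proof. by rewrite ((pcharf0P K).1 pcharK). Qed.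
Let ord_x : ord_ge e x. Proof. exact: ord_ge_Xn. Qed.
Let ord_y : ord_ge r y. Proof. exact: ord_ge_Xn. Qed.
Let ord_z : ord_ge s z. Proof. exact: ord_ge_Xn. Qed.
Let lead_x : x e = 1. Proof. exact: coef_powM_lead. Qed.
Let lead_y : y r = 1. Proof. exact: coef_powM_lead. Qed.
Let lead_z : z s = 1. Proof. exact: coef_powM_lead. Qed.
Let xx k : (k < e + e)%N -> (x * x) k = 0. Proof. exact: ord_geM. Qed.
Let xy k : (k < e + r)%N -> (x * y) k = 0. Proof. exact: ord_geM. Qed.
Let xz k : (k < e + s)%N -> (x * z) k = 0. Proof. exact: ord_geM. Qed.
Let yy k : (k < r + r)%N -> (y * y) k = 0. Proof. exact: ord_geM. Qed.
Let yz k : (k < r + s)%N -> (y * z) k = 0. Proof. exact: ord_geM. Qed.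
Let zz k : (k < s + s)%N -> (z * z) k = 0. Proof. exact: ord_geM. Qed.
Let lead_xx : (x * x) (e + e)%N = 1.
Proof. by rewrite coef_ord_geM // lead_x mulr1. Qed.
Let lead_xy : (x * y) (e + r)%N = 1.
Proof. by rewrite coef_ord_geM // lead_x lead_y mulr1. Qed.
Let lead_xz : (x * z) (e + s)%N = 1.
Proof. by rewrite coef_ord_geM // lead_x lead_z mulr1. Qed.
Let lead_yy : (y * y) (r + r)%N = 1.
Proof. by rewrite coef_ord_geM // lead_y mulr1. Qed.

(** Without corrections there are no terms linear in [y] or [z], and [x^2] dominates all the other
    products. *)
Lemma has_ord_defect_generic : m 0 0 != 0 -> has_ord (2 * e) (defect 0 0).
Proof.
move=> nz_m; have E k : (k <= e + e)%N -> defect 0 0 k = m 0 0 * (x * x) k.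
  move=> le_k; have lt_k n : (e < n)%N -> (k < e + n)%N by lia.
  rewrite sqrt_defectE //; move: ((x * x) k) (y k) (z k) => X Y Z.
  rewrite xy ?xz ?yy ?yz ?zz; try lia.
  by rewrite /square_defect; ring.
rewrite mul2n -addnn; split=> [k lt_k|]; rewrite E ?leqnn ?lead_xx ?mulr1 //; last exact: ltnW.
by rewrite xx ?mulr0.
Qed.

Lemma exists_correction (p : K) : q0 != 0 -> exists e1, 2%:R * q0 * e1 = p.
Proof.
move=> nz_q; exists (p / (2%:R * q0)).
by rewrite mulrC divfK // mulf_neq0.
Qed.

(** Substituting [x^2 = D + y + g z] gives [y] and [z] the coefficients [2 q e1 + m00] and
    [2 q e2 + m00 g], which the corrections cancel. Up to order [3e] only [D] and [x y] remain, and
    [x y] starts at [3e]. *)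
Lemma has_ord_defect_parabolic (g : K) (v : nat) (D := x * x - y - fpsC g * z) :
  r = (2 * e)%N -> (2 * e < s)%N -> (v <= 3 * e)%N -> ord_ge v D ->
  parabolic_cond S (D v) (v == 3 * e)%:R != 0 ->
  exists e1 e2, has_ord v (defect e1 e2).
Proof.
move=> re lt_s le_v Dv; rewrite /parabolic_cond mulf_eq0 negb_or => /andP[nz_q nz_cond].
have [e1 He1] := exists_correction (- m 0 0) nz_q.
have [e2 He2] := exists_correction (- (m 0 0 * g)) nz_q.
exists e1, e2.
have E k : (k <= 3 * e)%N ->
    defect e1 e2 k = m 0 0 * D k + 2%:R * (m 0 1 + S 0 ord_max * e1) * (x * y) k.
  move=> le_k; have Dk : (x * x) k = D k + y k + g * z k.
    by rewrite /D !coef_fpsB coef_fpsCM; ring.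
  rewrite sqrt_defectE // Dk; move: (D k) (y k) (z k) ((x * y) k) => d Y Z XY.
  rewrite xz ?yy ?yz ?zz; try lia.
  by rewrite /square_defect He1 He2; ring.
split=> [k lt_k|].
  by rewrite E ?Dv ?xy ?mulr0 ?addr0 //; lia.
apply: contraNneq nz_cond => E0; apply/eqP.
have xyv : (x * y) v = (v == 3 * e)%:R.
  have [->|ne_v] := eqVneq v (3 * e)%N; last by rewrite xy //; lia.
  by rewrite -lead_xy; congr (fcoef _ _); lia.
(* The factor [q0] clears the denominator of [2 e1]. *)
have := congr1 (fun t => q0 * t) E0; rewrite mulr0 E // xyv => <-.
move: (D v) ((v == _)%:R : K) => d t.
transitivity (q0 * (m 0 0 * d + 2%:R * m 0 1 * t) + S 0 ord_max * (- m 0 0) * t).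
  by ring.
by rewrite -He1; ring.
Qed.

(** Since also [x y = Y + z], the correction [e2] can absorb the term in [x y], whose coefficient
    involves [e1]. The new bound is the common order [4e] of [x z] and [y^2]. *)
Lemma has_ord_defect_cubic (g : K) (v : nat)
    (D := x * x - y - fpsC g * z) (Y := x * y - z) :
  r = (2 * e)%N -> s = (3 * e)%N -> (v <= 4 * e)%N -> ord_ge v D -> ord_ge v Y ->
  cubic_cond S g (D v) (Y v) (v == 4 * e)%:R != 0 ->
  exists e1 e2, has_ord v (defect e1 e2).
Proof.
move=> re se le_v Dv Yv; rewrite /cubic_cond mulf_eq0 negb_or => /andP[nz_q nz_cond].
have [e1 He1] := exists_correction (- m 0 0) nz_q.
have [e2 He2] :=
  exists_correction (- (m 0 0 * g + 2%:R * (m 0 1 + S 0 ord_max * e1))) nz_q.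
exists e1, e2.
have E k : (k <= 4 * e)%N ->
    defect e1 e2 k = m 0 0 * D k + 2%:R * (m 0 1 + S 0 ord_max * e1) * Y k
      + 2%:R * (m 0 2%:R + S 0 ord_max * e2) * (x * z) k
      + (m 1 1 + 2%:R * S 1 ord_max * e1 + e1 ^+ 2) * (y * y) k.
  move=> le_k; have Dk : (x * x) k = D k + y k + g * z k.
    by rewrite /D !coef_fpsB coef_fpsCM; ring.
  have Yk : (x * y) k = Y k + z k by rewrite /Y coef_fpsB subrK.
  rewrite sqrt_defectE // Dk Yk.
  move: (D k) (Y k) (y k) (z k) ((x * z) k) ((y * y) k) => d h Y' Z XZ YY.
  rewrite yz ?zz; try lia.
  by rewrite /square_defect He1 He2; ring.
split=> [k lt_k|].
  by rewrite E ?Dv ?Yv ?xz ?yy ?mulr0 ?addr0 //; lia.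
apply: contraNneq nz_cond => E0; apply/eqP.
have xzv : (x * z) v = (v == 4 * e)%:R.
  have [->|ne_v] := eqVneq v (4 * e)%N; last by rewrite xz //; lia.
  by rewrite -lead_xz; congr (fcoef _ _); lia.
have yyv : (y * y) v = (v == 4 * e)%:R.
  have [->|ne_v] := eqVneq v (4 * e)%N; last by rewrite yy //; lia.
  by rewrite -lead_yy; congr (fcoef _ _); lia.
(* The factor [4 q0^2] clears the denominators of [e1 ^+ 2] and of [e2], which itself contains
   [e1]. *)
have := congr1 (fun t => 4%:R * q0 ^+ 2 * t) E0; rewrite mulr0 E // xzv yyv => <-.
move: (D v) (Y v) ((v == _)%:R : K) => d h t.
have m00 : m 0 0 = - (2%:R * q0 * e1) by rewrite He1 opprK.
have c2 : m 0 0 * g = - (2%:R * q0 * e2) - 2%:R * (m 0 1 + S 0 ord_max * e1).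
  by rewrite He2 opprK addrK.
rewrite -[q0 * m 0 0 * g]mulrA c2 m00; ring.
Qed.

(** Here [z] absorbs [x^2], and [e1] is 0, since [y], of order [r < 2e], would otherwise be the
    leading term. The bound [e + r] is the order of [x y]; it becomes the bound [r] on the last
    entry of the type. *)
Lemma has_ord_defect_skew (v : nat) (D := x * x - z) :
  s = (2 * e)%N -> (v <= e + r)%N -> ord_ge v D ->
  skew_cond S (D v) (v == e + r)%:R != 0 ->
  exists e1 e2, has_ord v (defect e1 e2).
Proof.
move=> se le_v Dv; rewrite /skew_cond mulf_eq0 negb_or => /andP[nz_q nz_cond].
have [e2 He2] := exists_correction (- m 0 0) nz_q.
exists 0, e2.
have E k : (k <= e + r)%N ->
    defect 0 e2 k = m 0 0 * D k + 2%:R * m 0 1 * (x * y) k.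
  move=> le_k; have Dk : (x * x) k = D k + z k by rewrite /D coef_fpsB subrK.
  rewrite sqrt_defectE // Dk; move: (D k) (y k) (z k) ((x * y) k) => d Y Z XY.
  rewrite xz ?yy ?yz ?zz; try lia.
  by rewrite /square_defect He2; ring.
split=> [k lt_k|].
  by rewrite E ?Dv ?xy ?mulr0 ?addr0 //; lia.
rewrite E //; suff -> : (x * y) v = (v == e + r)%:R by [].
have [->|ne_v] := eqVneq v (e + r)%N; first exact: lead_xy.
by rewrite xy //; lia.
Qed.

End Cases.

(** * The conditions as nonzero homogeneous polynomials in the quadric *)

Section ConditionMorphisms.
Variables (A B : comNzRingType) (phi : {rmorphism A -> B}).
Variable S : 'I_4 -> 'I_4 -> A.
Let S' i j := phi (S i j).

Lemma rmorph_minor i j : phi (tangent_minor S i j) = tangent_minor S' i j.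
Proof. by rewrite /tangent_minor rmorphB !rmorphM. Qed.

Lemma rmorph_generic_cond : phi (generic_cond S) = generic_cond S'.
Proof. by rewrite /generic_cond rmorphM rmorph_minor. Qed.

Lemma rmorph_parabolic_cond x t :
  phi (parabolic_cond S x t) = parabolic_cond S' (phi x) (phi t).
Proof.
rewrite /parabolic_cond -!rmorph_minor /S'.
by rewrite !(rmorph_nat, rmorphXn, rmorphM, rmorphN, rmorphD).
Qed.

Lemma rmorph_cubic_cond g x y t :
  phi (cubic_cond S g x y t) = cubic_cond S' (phi g) (phi x) (phi y) (phi t).
Proof.
rewrite /cubic_cond -!rmorph_minor /S'.
by rewrite !(rmorph_nat, rmorphXn, rmorphM, rmorphN, rmorphD).
Qed.

Lemma rmorph_skew_cond x t :
  phi (skew_cond S x t) = skew_cond S' (phi x) (phi t).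
Proof.
rewrite /skew_cond -!rmorph_minor /S'.
by rewrite !(rmorph_nat, rmorphXn, rmorphM, rmorphN, rmorphD).
Qed.

End ConditionMorphisms.

Section Genericity.
Variable K : fieldType.
Hypothesis pcharK : [pchar K] =i pred0.

Let two_neq0 : 2%:R != 0 :> K.
Proof. by rewrite ((pcharf0P K).1 pcharK). Qed.

Lemma gram_surjective (S : 'M[K]_4) : S^T = S -> exists q, gram q = S.
Proof.
move=> symS; have sym i j : S i j = S j i by rewrite -{1}symS mxE.
pose i0 : 'I_4 := inord 0; pose i1 : 'I_4 := inord 1.
pose i2 : 'I_4 := inord 2; pose i3 : 'I_4 := inord 3.
(* An off-diagonal entry of the Gram matrix is counted twice in the quadratic form. *)
pose entry (ij : 'I_4 * 'I_4) := (if ij.1 == ij.2 then 1 else 2%:R) * S ij.1 ij.2.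
exists (\row_k entry (nth (ord0, ord0) quadric_monomials k)).
have E : gram (\row_k entry (nth (ord0, ord0) quadric_monomials k)) =
    \sum_(ij <- quadric_monomials) entry ij *: (2%:R^-1 *:
      (delta_mx ij.1 ij.2 + delta_mx ij.2 ij.1)).
  rewrite (big_nth (ord0, ord0)) big_mkord; apply: eq_bigr => k _.
  by rewrite mxE.
rewrite {}E /quadric_monomials !big_cons big_nil /entry /=.
have -> : inord 0 = 0 :> 'I_4 by apply: val_inj; rewrite /= inordK.
have -> : inord 1 = 1 :> 'I_4 by apply: val_inj; rewrite /= inordK.
have -> : inord 2 = 2%:R :> 'I_4 by apply: val_inj; rewrite /= inordK.
have -> : inord 3 = ord_max :> 'I_4 by apply: val_inj; rewrite /= inordK.
have cases (i : 'I_4) : [\/ i = 0, i = 1, i = 2%:R | i = ord_max].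
  by case: i => -[|[|[|[|//]]]] lti; [constructor 1|constructor 2|constructor 3|constructor 4];
    apply: val_inj.
apply/matrixP => i j; rewrite !mxE.
by case: (cases i) (cases j) => [] -> [] -> /=;
  rewrite ?(sym 1 0) ?(sym 2%:R 0) ?(sym 2%:R 1) ?(sym ord_max 0)
    ?(sym ord_max 1) ?(sym ord_max 2%:R); field.
Qed.

(** With [N = invmx M], these are the entries of the Gram matrix in the coordinates of the branch,
    as linear forms in the ten coefficients of the quadric. *)
Definition entry_poly (N : 'M[K]_4) (i j : 'I_4) : {mpoly K[10]} :=
  \sum_k (N *m monomial_mx K k *m N^T) i j *: 'X_k.

Lemma meval_entry_poly N i j (q : 'rV[K]_10) :
  (entry_poly N i j).@[q 0] = (N *m gram q *m N^T) i j.
Proof.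
rewrite raddf_sum /gram mulmx_sumr mulmx_suml summxE; apply: eq_bigr => k _.
by rewrite /= mevalZ mevalXU mulrC -(scalemxAr (q 0 k)) -(scalemxAl (q 0 k)) [RHS]mxE.
Qed.

Lemma entry_poly_homog N i j : entry_poly N i j \is 1.-homog.
Proof.
apply: rpred_sum => k _; apply: dhomogZ; rewrite dhomogX; apply/eqP.
exact: mdeg1.
Qed.

Lemma homogM (n d1 d2 d : nat) (F G : {mpoly K[n]}) :
  F \is d1.-homog -> G \is d2.-homog -> (d1 + d2)%N = d -> F * G \is d.-homog.
Proof. by move=> hF hG <-; apply: dhomogM. Qed.

Lemma homogC (n : nat) (x : K) : (x%:MP : {mpoly K[n]}) \is 0.-homog.
Proof. by rewrite -[x%:MP]mulr1 mul_mpolyC; apply: dhomogZ; apply: dhomog1. Qed.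

Lemma homog_nat (n k : nat) : (k%:R : {mpoly K[n]}) \is 0.-homog.
Proof. by rewrite -[k%:R]mpolyC_nat; apply: homogC. Qed.

Section Homogeneity.
Variable N : 'M[K]_4.
Local Notation S := (entry_poly N).
Local Notation m := (tangent_minor S).
Let hS := entry_poly_homog N.

Let hm i j : m i j \is 2.-homog.
Proof. by rewrite /tangent_minor; apply: rpredB; apply: homogM; first exact: hS. Qed.

Lemma generic_cond_homog : generic_cond S \is 3.-homog.
Proof. by apply: homogM (hS _ _) (hm _ _) _. Qed.

Lemma parabolic_cond_homog x t : parabolic_cond S x%:MP t%:MP \is 4.-homog.
Proof.
apply: (homogM (hS _ _) (d2 := 3)) => //; apply: rpredD.
  apply: (homogM (d1 := 3) _ (homogC _ _)) => //.
  exact: homogM (hS _ _) (hm _ _) _.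
apply: (homogM (d1 := 3) _ (homogC _ _)) => //; apply: rpredB.
  apply: (homogM (d1 := 1) _ (hm _ _)) => //.
  exact: homogM (homog_nat _ _) (hS _ _) _.
exact: homogM (hS _ _) (hm _ _) _.
Qed.

Lemma cubic_cond_homog g x y t :
  cubic_cond S g%:MP x%:MP y%:MP t%:MP \is 5.-homog.
Proof.
have hq : S ord_max ord_max ^+ 2 \is 2.-homog.
  by rewrite expr2; apply: homogM (hS _ _) (hS _ _) _.
have hqm k i j : k%:R * S ord_max ord_max ^+ 2 * m i j \is 4.-homog.
  by apply: homogM (homogM (homog_nat _ _) hq _) (hm _ _) _.
have hp : 2%:R * S ord_max ord_max * m 0 1 - S 0 ord_max * m 0 0 \is 3.-homog.
  apply: rpredB; last exact: homogM (hS _ _) (hm _ _) _.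
  exact: homogM (homogM (homog_nat _ _) (hS _ _) _) (hm _ _) _.
have hsm k i j : k%:R * S i j \is 1.-homog.
  exact: homogM (homog_nat _ _) (hS _ _) _.
apply: (homogM (hS _ _) (d2 := 4)) => //; rewrite /=.
do 2?apply: rpredD.
- exact: homogM (hqm _ _ _) (homogC _ _) _.
- exact: homogM (homogM (hsm _ _ _) hp _) (homogC _ _) _.
apply: (homogM (d1 := 4) _ (homogC _ _)) => //.
apply: rpredD; last by rewrite expr2; apply: homogM (hm _ _) (hm _ _) _.
apply: rpredB; last exact: homogM (homogM (hsm _ _ _) (hS _ _) _) (hm _ _) _.
apply: rpredB; first by apply: rpredD.
apply: (homogM (hsm _ _ _) (d2 := 3)) => //; apply: rpredD => //.
by apply: homogM (homogM (hS _ _) (hm _ _) _) (homogC _ _) _.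
Qed.

Lemma skew_cond_homog x t : skew_cond S x%:MP t%:MP \is 3.-homog.
Proof.
apply: (homogM (hS _ _) (d2 := 2)) => //; apply: rpredD.
  exact: homogM (hm _ _) (homogC _ _) _.
exact: homogM (homogM (homog_nat _ _) (hm _ _) _) (homogC _ _) _.
Qed.

End Homogeneity.

(** The quadric [p x^2 + 2 p' x y + w y^2 + 1]: here [q = 1] and the polar form of the base point is
    constant, so that the minors are opposites of entries and each choice isolates one term of a
    condition. *)
Definition test_mx (p p' w : K) : 'M[K]_4 :=
  \matrix_(i, j) nth 0 (nth [::] [:: [:: p; p'; 0; 0]; [:: p'; w; 0; 0];
                                     [:: 0; 0; 0; 0]; [:: 0; 0; 0; 1]] i) j.

Lemma test_mx_sym p p' w : (test_mx p p' w)^T = test_mx p p' w.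
Proof.
apply/matrixP => i j; rewrite !mxE.
by case: i j => -[|[|[|[|//]]]] ? [[|[|[|[|//]]]] ?].
Qed.

Lemma test_minor p p' w : let m := tangent_minor (test_mx p p' w) in
  [/\ m 0 0 = - p, m 0 1 = - p', m 1 1 = - w, m 0 2%:R = 0 &
      [/\ test_mx p p' w ord_max ord_max = 1, test_mx p p' w 0 ord_max = 0 &
          test_mx p p' w 1 ord_max = 0]].
Proof. by rewrite /tangent_minor !mxE /= !mulr0 !mul1r !sub0r oppr0. Qed.

Lemma generic_cond_neq0 : exists S : 'M[K]_4, S^T = S /\ generic_cond S != 0.
Proof.
exists (test_mx (- 1) 0 0); split; first exact: test_mx_sym.
have [m00 _ _ _ [q _ _]] := test_minor (- 1) 0 0.
by rewrite /generic_cond q m00 opprK mulr1 oner_neq0.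
Qed.

Lemma parabolic_cond_neq0 x t : x != 0 \/ t != 0 ->
  exists S : 'M[K]_4, S^T = S /\ parabolic_cond S x t != 0.
Proof.
have [->|nz_t _] := eqVneq t 0.
  case=> [nz_x|/eqP//]; exists (test_mx (- 1) 0 0); split; first exact: test_mx_sym.
  have [m00 _ _ _ [q _ _]] := test_minor (- 1) 0 0.
  by rewrite /parabolic_cond q m00 opprK mulr0 addr0 !mul1r.
exists (test_mx 0 (- 1) 0); split; first exact: test_mx_sym.
have [m00 m01 _ _ [q a _]] := test_minor 0 (- 1) 0.
rewrite /parabolic_cond q a m00 m01 (_ : _ * _ = 2%:R * t); last by ring.
exact: mulf_neq0.
Qed.

Lemma cubic_cond_neq0 g x y t : [\/ x != 0, y != 0 | t != 0] ->
  exists S : 'M[K]_4, S^T = S /\ cubic_cond S g x y t != 0.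
Proof.
have four_neq0 : 4%:R != 0 :> K by rewrite ((pcharf0P K).1 pcharK).
have eight_neq0 : 8%:R != 0 :> K by rewrite ((pcharf0P K).1 pcharK).
have [->|nz_t _] := eqVneq t 0; last first.
  exists (test_mx 0 0 (- 1)); split; first exact: test_mx_sym.
  have [m00 m01 m11 m02 [q a1 a2]] := test_minor 0 0 (- 1).
  rewrite /cubic_cond q a1 a2 m00 m01 m11 m02 (_ : _ * _ = 4%:R * t); last by ring.
  exact: mulf_neq0.
have [->|nz_x _] := eqVneq x 0; last first.
  exists (test_mx (- 1) 0 0); split; first exact: test_mx_sym.
  have [m00 m01 m11 m02 [q a1 a2]] := test_minor (- 1) 0 0.
  rewrite /cubic_cond q a1 a2 m00 m01 m11 m02 (_ : _ * _ = 4%:R * x); last by ring.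
  exact: mulf_neq0.
case=> [/eqP//|nz_y|/eqP//].
exists (test_mx 0 (- 1) 0); split; first exact: test_mx_sym.
have [m00 m01 m11 m02 [q a1 a2]] := test_minor 0 (- 1) 0.
rewrite /cubic_cond q a1 a2 m00 m01 m11 m02 (_ : _ * _ = 8%:R * y); last by ring.
exact: mulf_neq0.
Qed.

Lemma skew_cond_neq0 x t : x != 0 \/ t != 0 ->
  exists S : 'M[K]_4, S^T = S /\ skew_cond S x t != 0.
Proof.
have [->|nz_t _] := eqVneq t 0.
  case=> [nz_x|/eqP//]; exists (test_mx (- 1) 0 0); split; first exact: test_mx_sym.
  have [m00 _ _ _ [q _ _]] := test_minor (- 1) 0 0.
  by rewrite /skew_cond q m00 opprK mulr0 addr0 !mul1r.
exists (test_mx 0 (- 1) 0); split; first exact: test_mx_sym.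
have [m00 m01 _ _ [q _ _]] := test_minor 0 (- 1) 0.
rewrite /skew_cond q m00 m01 (_ : _ * _ = 2%:R * t); last by ring.
exact: mulf_neq0.
Qed.

(* The condition [cond] bears on the Gram matrix of the quadric in the
   coordinates given by [M], and [G] expresses it on the quadric itself. *)
Lemma for_generic_quadric_cond (M : 'M[K]_4) (cond : 'M[K]_4 -> K) d
    (G : {mpoly K[10]}) (P : {mpoly K[4]} -> Prop)
    (coord := fun q => invmx M *m gram q *m (invmx M)^T) :
  M \in unitmx -> (forall q : 'rV[K]_10, G.@[q 0] = cond (coord q)) ->
  G \is d.-homog ->
  (exists S, S^T = S /\ cond S != 0) ->
  (forall q, (coord q)^T = coord q -> cond (coord q) != 0 -> P (quadric q)) ->
  for_generic_quadric P.
Proof.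
move=> unitM GE hG [S [symS nzS]] condP; exists d, G; split=> // [|q _].
  have [|q qE] := @gram_surjective (M *m S *m M^T).
    by rewrite !trmx_mul trmxK symS mulmxA.
  apply: contraNneq nzS => G0; move: (GE q).
  rewrite G0 meval0 /coord qE -!mulmxA -trmx_mul mulVmx // trmx1 mulmx1.
  by rewrite mulmxA mulVmx // mul1mx => <-.
rewrite GE; apply: condP.
by rewrite /coord !trmx_mul trmxK gram_sym mulmxA.
Qed.

End Genericity.

(** * Truncated valuations *)

Section Valuations.
Variable K : comNzRingType.
Implicit Type f : fps K.

(** The final dichotomy, bound attained or coefficient nonzero, is the form in which a valuation
    makes one of the conditions a nonzero polynomial. *)
Lemma min_on_val N f (v := min_on N (val_u f)) :
  [/\ (v <= N)%N, ord_ge v f & v = N \/ f v != 0].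
Proof.
rewrite {}/v; have := val_u_ord f; case: (val_u f) => [n [fn nz]|->] /=; last first.
  by split=> //; [exact: ord_ge_zero | left].
split; first exact: geq_minl.
  by apply: ord_geW fn; apply: geq_minr.
by rewrite /minn; case: ifP; [left | right].
Qed.

Lemma le_on_val N f : le_on N (val_u f) -> ord_ge N f.
Proof.
have := val_u_ord f; case: (val_u f) => [n [fn _] /= le_N|-> _].
  exact: ord_geW fn.
exact: ord_ge_zero.
Qed.

Lemma val_u_ge N f n : ord_ge N f -> val_u f = Some n -> (N <= n)%N.
Proof.
move=> fN vf; have := val_u_ord f; rewrite vf => -[_ nz]; rewrite leqNgt.
by apply: contraNN nz => /fN ->; rewrite eqxx.
Qed.

Lemma min_on_gt N f v : (v <= N)%N -> ord_ge v f -> (v <= min_on N (val_u f))%N.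
Proof.
move=> le_vN fv; case E: (val_u f) => [n|] //=.
by rewrite leq_min le_vN (val_u_ge fv E).
Qed.

Lemma min_on_sub N e f :
  min_on N (sub_on (val_u f) e) = (min_on (N + e) (val_u f) - e)%N.
Proof.
case: (val_u f) => [n|] /=; lia.
Qed.

End Valuations.

(** * The five cases of the theorem *)

Section HalphenBranch.
Variable K : fieldType.
Hypothesis pcharK : [pchar K] =i pred0.
Variables (X : 'rV[K]_4 -> Prop) (beta : 'rV[fps K]_4).
Hypotheses (curveX : irreducible_curve X) (onX : lies_on X beta).
Variables (e r s : nat) (a b c : fps K).
Hypotheses (e_gt0 : (0 < e)%N) (lt_er : (e < r)%N) (lt_rs : (r < s)%N).
Hypotheses (a0 : a 0%N = 1) (b0 : b 0%N = 1) (c0 : c 0%N = 1).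
Variables (M : 'M[K]_4) (l : fps K).
Hypotheses (unitM : M \in unitmx) (nz_l : l != 0).
Local Notation alpha := (standard_param e r s a b c).
Hypothesis betaM : beta *m map_mx (@fpsC K) M = l *: alpha.
Local Notation coord q := (invmx M *m gram q *m (invmx M)^T).
Local Notation x := ('u ^+ e * a).
Local Notation y := ('u ^+ r * b).
Local Notation z := ('u ^+ s * c).

Let bilinear_scale (A : comNzRingType) (S N : 'M[A]_4) (t : A) (v : 'rV[A]_4) :
  bilinear_mx S (t *: (v *m N)) (t *: (v *m N))
  = t * (t * bilinear_mx (N *m S *m N^T) v v).
Proof. by rewrite bilinear_mxZl bilinear_mxZr bilinear_mx_mul. Qed.

Lemma branch_type_of_normal_form q x1 x2 x3 :
  (coord q)^T = coord q -> coord q ord_max ord_max != 0 ->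
  (exists a' b' c', normal_form (gram_halphen (coord q) alpha) x1 x2 x3 a' b' c') ->
  branch_of_type (halphen_transform X (quadric q)) (halphen_param (quadric q) beta)
    x1 x2 x3.
Proof.
move=> symS nz_q [a' [b' [c' nf]]].
have nf' := normal_form_transport pcharK unitM nz_l betaM nf.
split; last by exists a', b', c'.
have betaE : beta = l *: (alpha *m map_mx (@fpsC K) (invmx M)).
  by rewrite scalemxAl -betaM -mulmxA -map_mxM mulmxV // map_mx1 mulmx1.
have nz_Q : bilinear_mx (map_mx (@fpsC K) (gram q)) beta beta != 0.
  rewrite betaE bilinear_scale !mulf_neq0 //.
  have -> : map_mx (@fpsC K) (invmx M) *m map_mx (@fpsC K) (gram q)
      *m (map_mx (@fpsC K) (invmx M))^T = map_mx (@fpsC K) (coord q).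
    by rewrite map_trmx -!map_mxM.
  have := quadratic0 a b c e_gt0 lt_er lt_rs symS nz_q.
  by move: (bilinear_mx _ _ _) => B B0; apply: contraNneq nz_q => E; rewrite -B0 E coef_fps0.
have alpha00 : alpha 0 0 = x by rewrite mxE.
have alpha03 : alpha 0 ord_max = 1 by rewrite mxE.
have ord_x : has_ord e x.
  by split; [exact: ord_ge_Xn | rewrite coef_powM_lead ?oner_neq0].
apply: (halphen_on_transform pcharK curveX onX unitM nz_l betaM _ _ alpha03 nz_Q).
- by rewrite alpha00; apply: ord_geW ord_x.1.
- by rewrite alpha00; apply: has_ord_neq0 ord_x.
- exact: normal_form_neq0 nf'.
Qed.

Lemma branch_type q x1 x2 x3 e1 e2 v (i0 i1 i2 i3 : 'I_4)
    (o := orders e r s v) :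
  (coord q)^T = coord q -> coord q ord_max ord_max != 0 ->
  has_ord v (sqrt_defect e r s a b c (coord q) e1 e2) ->
  [/\ (0 < o i0)%N, (o i0 < o i1)%N, (o i1 < o i2)%N & (o i2 < o i3)%N] ->
  [/\ (0 < v)%N, o i1 = x1 + o i0, o i2 = x2 + o i0 & o i3 = x3 + o i0]%N ->
  branch_of_type (halphen_transform X (quadric q)) (halphen_param (quadric q) beta)
    x1 x2 x3.
Proof.
move=> symS nz_q ordv [lt0 lt1 lt2 lt3] [v0 E1 E2 E3].
apply: branch_type_of_normal_form => //.
exact: (halphen_type pcharK e_gt0 lt_er lt_rs a0 b0 c0 symS nz_q v0 ordv lt0 lt1 lt2 lt3).
Qed.

Let i1 : 'I_4 := 1.
Let i2 : 'I_4 := 2%:R.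
Let i3 : 'I_4 := ord_max.

Local Notation Phi_has_type Q x1 x2 x3 :=
  (branch_of_type (halphen_transform X Q) (halphen_param Q beta) x1 x2 x3).

Lemma halphen_branch_generic : (r <> 2 * e)%N -> (s <> 2 * e)%N ->
  for_generic_quadric (fun Q => exists x1 x2 x3 : nat,
    Phi_has_type Q x1 x2 x3 /\ [:: x1; x2; x3] =i [:: e; r - e; s - e]%N).
Proof.
move=> r2e s2e.
apply: (@for_generic_quadric_cond _ pcharK M (fun S => generic_cond S) 3
  (generic_cond (entry_poly (invmx M)))) => //; first last.
- move=> q symS nz_cond.
  have [nz_q nz_m] : coord q ord_max ord_max != 0
      /\ tangent_minor (coord q) 0 0 != 0.
    by apply/andP; rewrite -negb_or -mulf_eq0.
  have ordv := has_ord_defect_generic pcharK b c e_gt0 lt_er lt_rs a0 symS nz_m.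
  (* The defect has order [2e], distinct from [r] and [s]; its position among them decides how the
     entries are sorted. *)
  have [lt_2er|le_r2e] := ltnP (2 * e) r.
    exists e, (r - e)%N, (s - e)%N; split=> //.
    apply: (branch_type (i0 := 0) (i1 := i3) (i2 := i1) (i3 := i2) symS nz_q ordv);
      by split; rewrite /orders /=; lia.
  have [lt_2es|le_s2e] := ltnP (2 * e) s.
    exists (r - e)%N, e, (s - e)%N; split; last first.
      by move=> n; rewrite !inE; do !case: eqP.
    apply: (branch_type (i0 := 0) (i1 := i1) (i2 := i3) (i3 := i2) symS nz_q ordv);
      by split; rewrite /orders /=; lia.
  exists (r - e)%N, (s - e)%N, e; split; last first.
    by move=> n; rewrite !inE; do !case: eqP.
  apply: (branch_type (i0 := 0) (i1 := i1) (i2 := i2) (i3 := i3) symS nz_q ordv);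
    by split; rewrite /orders /=; lia.
- exact: generic_cond_neq0.
- exact: generic_cond_homog.
move=> q; rewrite [LHS](rmorph_generic_cond (meval (q 0))) /generic_cond /tangent_minor.
by rewrite /= !meval_entry_poly.
Qed.

Let generic_parabolic (g : K) (v : nat) (D := x * x - y - fpsC g * z) P :
  r = (2 * e)%N -> (2 * e < s)%N -> (v <= 3 * e)%N -> ord_ge v D ->
  v = (3 * e)%N \/ D v != 0 ->
  (forall q e1 e2, (coord q)^T = coord q -> coord q ord_max ord_max != 0 ->
    has_ord v (sqrt_defect e r s a b c (coord q) e1 e2) -> P (quadric q)) ->
  for_generic_quadric P.
Proof.
move=> re lt_s le_v Dv vD PQ.
apply: (@for_generic_quadric_cond _ pcharK M
  (fun S => parabolic_cond S (D v) (v == 3 * e)%:R) 4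
  (parabolic_cond (entry_poly (invmx M)) (D v)%:MP ((v == 3 * e)%:R)%:MP)) => //; first last.
- move=> q symS nz_cond.
  have nz_q : coord q ord_max ord_max != 0.
    by move: nz_cond; rewrite /parabolic_cond mulf_eq0 negb_or => /andP[].
  have [e1 [e2 ordv]] := has_ord_defect_parabolic pcharK e_gt0 lt_er lt_rs a0 b0
    symS re lt_s le_v Dv nz_cond.
  exact: PQ symS nz_q ordv.
- apply: parabolic_cond_neq0 => //.
  by case: vD => [->|]; [right; rewrite eqxx oner_neq0 | left].
- exact: parabolic_cond_homog.
move=> q; rewrite [LHS](rmorph_parabolic_cond (meval (q 0))) /= !mevalC.
by rewrite /parabolic_cond /tangent_minor /= !meval_entry_poly.
Qed.

Let generic_cubic (g : K) (v : nat) (D := x * x - y - fpsC g * z)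
    (Y := x * y - z) P :
  r = (2 * e)%N -> s = (3 * e)%N -> (v <= 4 * e)%N -> ord_ge v D -> ord_ge v Y ->
  [\/ D v != 0, Y v != 0 | v = (4 * e)%N] ->
  (forall q e1 e2, (coord q)^T = coord q -> coord q ord_max ord_max != 0 ->
    has_ord v (sqrt_defect e r s a b c (coord q) e1 e2) -> P (quadric q)) ->
  for_generic_quadric P.
Proof.
move=> re se le_v Dv Yv vDY PQ.
apply: (@for_generic_quadric_cond _ pcharK M
  (fun S => cubic_cond S g (D v) (Y v) (v == 4 * e)%:R) 5
  (cubic_cond (entry_poly (invmx M)) g%:MP (D v)%:MP (Y v)%:MP ((v == 4 * e)%:R)%:MP)) => //;
  first last.
- move=> q symS nz_cond.
  have nz_q : coord q ord_max ord_max != 0.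
    by move: nz_cond; rewrite /cubic_cond mulf_eq0 negb_or => /andP[].
  have [e1 [e2 ordv]] := has_ord_defect_cubic pcharK e_gt0 lt_er lt_rs a0 b0 c0
    symS re se le_v Dv Yv nz_cond.
  exact: PQ symS nz_q ordv.
- apply: cubic_cond_neq0 => //.
  by case: vDY => [nz|nz|->]; [constructor 1|constructor 2|constructor 3; rewrite eqxx oner_neq0].
- exact: cubic_cond_homog.
move=> q; rewrite [LHS](rmorph_cubic_cond (meval (q 0))) /= !mevalC.
by rewrite /cubic_cond /tangent_minor /= !meval_entry_poly.
Qed.

Let generic_skew (v : nat) (D := x * x - z) P :
  s = (2 * e)%N -> (v <= e + r)%N -> ord_ge v D -> v = (e + r)%N \/ D v != 0 ->
  (forall q e1 e2, (coord q)^T = coord q -> coord q ord_max ord_max != 0 ->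
    has_ord v (sqrt_defect e r s a b c (coord q) e1 e2) -> P (quadric q)) ->
  for_generic_quadric P.
Proof.
move=> se le_v Dv vD PQ.
apply: (@for_generic_quadric_cond _ pcharK M
  (fun S => skew_cond S (D v) (v == e + r)%:R) 3
  (skew_cond (entry_poly (invmx M)) (D v)%:MP ((v == e + r)%:R)%:MP)) => //; first last.
- move=> q symS nz_cond.
  have nz_q : coord q ord_max ord_max != 0.
    by move: nz_cond; rewrite /skew_cond mulf_eq0 negb_or => /andP[].
  have [e1 [e2 ordv]] := has_ord_defect_skew pcharK e_gt0 lt_er lt_rs a0 b0
    symS se le_v Dv nz_cond.
  exact: PQ symS nz_q ordv.
- apply: skew_cond_neq0 => //.
  by case: vD => [->|]; [right; rewrite eqxx oner_neq0 | left].
- exact: skew_cond_homog.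
move=> q; rewrite [LHS](rmorph_skew_cond (meval (q 0))) /= !mevalC.
by rewrite /skew_cond /tangent_minor /= !meval_entry_poly.
Qed.

Let ord_x : ord_ge e x. Proof. exact: ord_ge_Xn. Qed.
Let ord_y : ord_ge r y. Proof. exact: ord_ge_Xn. Qed.
Let ord_z : ord_ge s z. Proof. exact: ord_ge_Xn. Qed.
Let lead_x : x e = 1. Proof. exact: coef_powM_lead. Qed.
Let lead_y : y r = 1. Proof. exact: coef_powM_lead. Qed.
Let lead_z : z s = 1. Proof. exact: coef_powM_lead. Qed.

Let ord_square_sub n (f : fps K) :
  n = (2 * e)%N -> ord_ge n f -> f n = 1 -> ord_ge n.+1 (x * x - f).
Proof.
move=> -> fn lead_f; apply: ord_geS.
  by apply: ord_geB => //; rewrite mul2n -addnn; apply: ord_geM.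
by rewrite coef_fpsB lead_f mul2n -addnn coef_ord_geM // lead_x mulr1 subrr.
Qed.

(** No multiple of [z] is subtracted, that is [g = 0]. The terms of order [2e] of [x^2] and [y]
    cancel, so that the order [v] of the defect exceeds [r]; it differs from [s] by hypothesis, and
    may lie on either side of it. *)
Lemma halphen_branch_parabolic (v2 := val_u (x ^+ 2 - y)) :
  r = (2 * e)%N -> s <> min_on (3 * e) v2 ->
  for_generic_quadric (fun Q => exists x1 x2 x3 : nat, Phi_has_type Q x1 x2 x3 /\
    [:: x1; x2; x3] =i [:: e; min_on (2 * e) (sub_on v2 e); s - e]%N).
Proof.
move=> re ne_s; have [le_v Dv vD] := min_on_val (3 * e) (x ^+ 2 - y).
have D1 : ord_ge (2 * e).+1 (x ^+ 2 - y).
  by rewrite expr2 -re; apply: ord_square_sub.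
have gt_v : (2 * e < min_on (3 * e) v2)%N by apply: min_on_gt => //; lia.
rewrite min_on_sub (_ : (2 * e + e = 3 * e)%N); last by lia.
rewrite -/v2 in le_v Dv vD; set v := min_on _ v2 in ne_s le_v Dv vD gt_v *.
have DE : x ^+ 2 - y = x * x - y - fpsC 0 * z by rewrite rmorph0 mul0r subr0.
rewrite DE in Dv vD.
have lt_s : (2 * e < s)%N by lia.
apply: (generic_parabolic re lt_s le_v Dv vD) => q e1 e2 symS nz_q ordv.
have [lt_vs|le_sv] := ltnP v s.
  exists e, (v - e)%N, (s - e)%N; split=> //.
  apply: (branch_type (i0 := 0) (i1 := i1) (i2 := i3) (i3 := i2) symS nz_q ordv);
    by split; rewrite /orders /=; lia.
exists e, (s - e)%N, (v - e)%N; split; last first.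
  by move=> n; rewrite !inE; do !case: eqP.
apply: (branch_type (i0 := 0) (i1 := i1) (i2 := i2) (i3 := i3) symS nz_q ordv);
  by split; rewrite /orders /=; lia.
Qed.

(* Modulo terms of high order, [y] is the square of [x], and then the left-hand
   side is the derivative of [z - x * y]. *)
Let cubic_derivation (A : comNzRingType) (d : {additive A -> A}) (x y z : A) :
  (forall x y, d (x * y) = d x * y + x * d y) ->
  d x * y - (d y * x) *+ 2 + d z
  = - d (x * y - z) - (d x * (x * x - y)) *+ 2 + d (x * x - y) * x.
Proof. by move=> dM; rewrite !raddfB /= !dM; ring. Qed.

(** Unfolding the product of series turns this coefficient into the sum that defines [gamma] in the
    theorem. *)
Let gamma := (x * x - y) s.

Let ord_gamma : ord_ge s (x * x - y) -> ord_ge s.+1 (x * x - y - fpsC gamma * z).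
Proof.
move=> D0; apply: ord_geS; first by apply: ord_geB => //; apply: ord_geMl.
by rewrite coef_fpsB coef_fpsCM lead_z mulr1 subrr.
Qed.

(** With [g = 0] the defect would generically have order [s], already the order of [z]. Taking
    [g = gamma] cancels this coefficient and moves the order beyond [s]. *)
Lemma halphen_branch_osculating (v2 := val_u (x ^+ 2 - y))
    (v2' := val_u (x ^+ 2 - y - fpsC gamma * z)) :
  r = (2 * e)%N -> v2 = Some s -> (s < 3 * e)%N ->
  for_generic_quadric (fun Q =>
    Phi_has_type Q e (s - e)%N (min_on (2 * e) (sub_on v2' e))).
Proof.
move=> re v2s lt_s3.
have [D0 _] : has_ord s (x * x - y) by have := val_u_ord (x ^+ 2 - y); rewrite -/v2 v2s.
have [le_v Dv vD] := min_on_val (3 * e) (x ^+ 2 - y - fpsC gamma * z).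
have gt_v : (s < min_on (3 * e) v2')%N by apply: min_on_gt => //; exact: ord_gamma.
rewrite min_on_sub (_ : (2 * e + e = 3 * e)%N); last by lia.
rewrite -/v2' in le_v Dv vD; set v := min_on _ v2' in le_v Dv vD gt_v *.
have lt_s : (2 * e < s)%N by lia.
apply: (generic_parabolic re lt_s le_v Dv vD) => q e1 e2 symS nz_q ordv.
apply: (branch_type (i0 := 0) (i1 := i1) (i2 := i2) (i3 := i3) symS nz_q ordv);
  by split; rewrite /orders /=; lia.
Qed.

Lemma halphen_branch_cubic (v2 := val_u (x ^+ 2 - y))
    (v2' := val_u (x ^+ 2 - y - fpsC gamma * z)) (v12 := val_u (x * y - z))
    (vd := val_u (fps_deriv x * y - (fps_deriv y * x) *+ 2 + fps_deriv z)) :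
  r = (2 * e)%N -> s = (3 * e)%N -> le_on (3 * e) v2 ->
  for_generic_quadric (fun Q => Phi_has_type Q e (2 * e)%N
    (min_on (min_on (min_on (3 * e) (sub_on v2' e)) (sub_on v12 e))
       (add_on (sub_on vd e) 1))).
Proof.
move=> re se le_v2.
have D0 : ord_ge s (x * x - y) by rewrite se; apply: le_on_val.
have D1 := ord_gamma D0.
(* The leading coefficients are all 1, so [x * y] and [z] cancel at order [3e = s]. *)
have Y1 : ord_ge s.+1 (x * y - z).
  apply: ord_geS; first by apply: ord_geB => //; rewrite se (_ : 3 * e = e + r)%N;
    [apply: ord_geM | lia].
  rewrite coef_fpsB lead_z se (_ : 3 * e = e + r)%N; last by lia.
  by rewrite coef_ord_geM // lead_x lead_y mulr1 subrr.
rewrite !expr2 in v2 v2' le_v2 *.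
(* The minima are taken one at a time, all shifted by [e]: [B] accounts for the bound [4e] and the
   first valuation, [v] also for the second. *)
rewrite [min_on (3 * e) _]min_on_sub (_ : (3 * e + e = 4 * e)%N); last by lia.
have [le_B DB B_D] := min_on_val (4 * e) (x * x - y - fpsC gamma * z).
have gt_B : (s < min_on (4 * e) v2')%N by apply: min_on_gt => //; lia.
rewrite -/v2' in le_B DB B_D; set B := min_on _ v2' in le_B DB B_D gt_B *.
rewrite [min_on (B - e) _]min_on_sub subnK; last by lia.
have [le_v Yv vY] := min_on_val B (x * y - z).
have gt_v : (s < min_on B v12)%N by apply: min_on_gt => //; lia.
rewrite -/v12 in le_v Yv vY; set v := min_on _ v12 in le_v Yv vY gt_v *.
(* The expression under [vd] has order at least [v - 1]: differentiation costs one, which the final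
   [+ 1] restores. *)
have -> : min_on (v - e) (add_on (sub_on vd e) 1) = (v - e)%N.
  have := @val_u_ge _ v.-1 (fps_deriv x * y - (fps_deriv y * x) *+ 2 + fps_deriv z).
  rewrite -/vd; case: vd => [n|] //= ge_n; suff : (v.-1 <= n)%N by lia.
  apply: ge_n => //; rewrite (@cubic_derivation _ (@fps_deriv K)); last exact: fps_derivM.
  apply: ord_geD; first apply: ord_geB.
  - by apply: ord_geN; apply: ord_ge_deriv; rewrite prednK //; lia.
  - apply: ord_geMn; have lt_e : (v.-1 <= e.-1 + s)%N by lia.
    apply: ord_geW lt_e _; apply: ord_geM => //.
    by apply: ord_ge_deriv; rewrite prednK.
  have lt_e : (v.-1 <= s.-1 + e)%N by lia.
  apply: ord_geW lt_e _; apply: ord_geM => //.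
  by apply: ord_ge_deriv; rewrite prednK //; lia.
have le_v4 : (v <= 4 * e)%N by lia.
have Dv : ord_ge v (x * x - y - fpsC gamma * z) by apply: ord_geW DB.
have vDY : [\/ (x * x - y - fpsC gamma * z) v != 0, (x * y - z) v != 0 | v = (4 * e)%N].
  case: vY => [vB|nz]; last by constructor 2.
  by rewrite vB; case: B_D => [->|nz]; [constructor 3|constructor 1].
apply: (generic_cubic re se le_v4 Dv Yv vDY) => q e1 e2 symS nz_q ordv.
apply: (branch_type (i0 := 0) (i1 := i1) (i2 := i2) (i3 := i3) symS nz_q ordv);
  by split; rewrite /orders /=; lia.
Qed.

(** The terms of order [2e] of [x^2] and [z] cancel, hence [r < s < v] and the orders are already
    sorted. *)
Lemma halphen_branch_skew (v3 := val_u (x ^+ 2 - z)) : s = (2 * e)%N ->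
  for_generic_quadric (fun Q =>
    Phi_has_type Q (r - e)%N e (min_on r (sub_on v3 e))).
Proof.
move=> se; have [le_v Dv vD] := min_on_val (e + r) (x ^+ 2 - z).
have D1 : ord_ge (2 * e).+1 (x ^+ 2 - z).
  by rewrite expr2 -se; apply: ord_square_sub.
have gt_v : (2 * e < min_on (e + r) v3)%N by apply: min_on_gt => //; lia.
rewrite min_on_sub addnC; rewrite -/v3 in le_v Dv vD.
set v := min_on _ v3 in le_v Dv vD gt_v *.
apply: (generic_skew se le_v Dv vD) => q e1 e2 symS nz_q ordv.
apply: (branch_type (i0 := 0) (i1 := i1) (i2 := i2) (i3 := i3) symS nz_q ordv);
  by split; rewrite /orders /=; lia.
Qed.

End HalphenBranch.

Theorem proposition15 (R : realType) (C : 'rV[R[i]]_4 -> Prop)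
    (hC : irreducible_curve C)
    (beta : 'rV[fps R[i]]_4) (hB : lies_on C beta)
    (e r s : nat) (a b c : fps R[i])
    (hN : normal_form beta e r s a b c)
    (hn0 : second_exponent a <> Some r)
    (hk0 : second_exponent b <> Some s) :
  let alpha1 : fps R[i] := 'u ^+ e * a in
  let alpha2 : fps R[i] := 'u ^+ r * b in
  let alpha3 : fps R[i] := 'u ^+ s * c in
  let gamma := \sum_(k < s.+1) alpha1 k * alpha1 (s - k)%N - alpha2 s in
  let v2 := val_u (alpha1 ^+ 2 - alpha2) in
  let v2' := val_u (alpha1 ^+ 2 - alpha2 - fpsC gamma * alpha3) in
  let v12 := val_u (alpha1 * alpha2 - alpha3) in
  let vd := val_u (fps_deriv alpha1 * alpha2
                   - (fps_deriv alpha2 * alpha1) *+ 2 + fps_deriv alpha3) in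
  let v3 := val_u (alpha1 ^+ 2 - alpha3) in
  let Phi_has_type Q x y z :=
    branch_of_type (halphen_transform C Q) (halphen_param Q beta) x y z in
  [/\ (r <> 2 * e)%N -> (s <> 2 * e)%N ->
        for_generic_quadric (fun Q => exists x y z : nat,
          Phi_has_type Q x y z /\
          [:: x; y; z] =i [:: e; r - e; s - e]%N),
      r = (2 * e)%N -> s <> min_on (3 * e) v2 ->
        for_generic_quadric (fun Q => exists x y z : nat,
          Phi_has_type Q x y z /\
          [:: x; y; z] =i [:: e; min_on (2 * e) (sub_on v2 e); s - e]%N),
      r = (2 * e)%N -> v2 = Some s -> (s < 3 * e)%N ->
        for_generic_quadric (fun Q =>
          Phi_has_type Q e (s - e)%N (min_on (2 * e) (sub_on v2' e))),
      r = (2 * e)%N -> s = (3 * e)%N -> le_on (3 * e) v2 ->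
        for_generic_quadric (fun Q =>
          Phi_has_type Q e (2 * e)%N
            (min_on (min_on (min_on (3 * e) (sub_on v2' e)) (sub_on v12 e))
                  (add_on (sub_on vd e) 1))) &
      s = (2 * e)%N ->
        for_generic_quadric (fun Q =>
          Phi_has_type Q (r - e)%N e (min_on r (sub_on v3 e)))].
Proof.
move=> alpha1 alpha2 alpha3 gamma v2 v2' v12 vd v3 Phi_has_type.
have pcharC : [pchar R[i]] =i pred0 by apply: Num.Theory.pchar_num.
have [/andP[e_gt0 lt_er] lt_rs [a0 b0 c0] [M [l [unitM nz_l betaM]]]] := hN.
split.
- exact: (halphen_branch_generic pcharC hC hB e_gt0 lt_er lt_rs a0 b0 c0 unitM nz_l betaM).
- exact: (halphen_branch_parabolic pcharC hC hB e_gt0 lt_er lt_rs a0 b0 c0 unitM nz_l betaM).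
- exact: (halphen_branch_osculating pcharC hC hB e_gt0 lt_er lt_rs a0 b0 c0 unitM nz_l betaM).
- exact: (halphen_branch_cubic pcharC hC hB e_gt0 lt_er lt_rs a0 b0 c0 unitM nz_l betaM).
- exact: (halphen_branch_skew pcharC hC hB e_gt0 lt_er lt_rs a0 b0 c0 unitM nz_l betaM).
Qed.
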